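(* The map $G^{m}$ is an isometric isomorphism from $H$ onto $H^{Im}$, $G^{m}\circ A=A^{m}\circ G^{m}$, $G^{m}\circ A^{*}=A^{*m}\circ G^{m}$, and $A^{*m}$ and $A^{*m}\restriction H^{Im}$ are the adjoints of $A^{m}$ and $A^{m}\restriction H^{Im}$, respectively.
   Context: Inner products are linear in the second argument. $H$ is a (nonzero) separable complex Hilbert space and $A=qV$ with $q\in\mathbb{C}\setminus\{0\}$ and $V$ a unitary operator on $H$; thus $A^{*}A=AA^{*}=r_{A}I$ with $r_A=|q|^2>0$. For $P\in\mathbb{C}[X,Y]$, $P(A,A^{*})$ is the operator obtained by substituting $A$ for $X$ and $A^{*}$ for $Y$. $\phi\in H$ is a fixed vector of norm $1$ that is cyclic: $\{P(A,A^{*})(\phi)\mid P\in\mathbb{C}[X,Y]\}$ is dense in $H$. For $N\in\omega$: $H_N$ is the span of $\{A^{i}(A^{*})^{j}\phi\mid i\le N,\ j\le N\}$, $H_N^{-}$ the span of those with $i<N,\ j\le N$, and $H_N^{+}$ the span of those with $0<i\le N,\ j\le N$. $W^{-}$, $W^{+}$ are the orthogonal complements of $H_N^{-}$, $H_N^{+}$ in $H_N$ (they have equal dimension). Fix a unitary $U_N:W^{-}\to W^{+}$, and let $A_N$ be the linear operator on $H_N$ with $A_N(u)=A(u)$ for $u\in H_N^{-}$ and $A_N(u)=\sqrt{r_A}\,U_N(u)$ for $u\in W^{-}$. Then $A_N^{*}A_N=A_NA_N^{*}=r_AI$. $\mathcal{U}$ is an ultrafilter on $\omega$ such that for all $m\ge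 1$, $\{N\ge 1\mid \sqrt N\in\omega,\ m\text{ divides }\sqrt N\}\in\mathcal{U}$. $H^{u}=\prod_{N}H_N/\mathcal{U}$ is the classical ultraproduct, and $\|\cdot\|_2^u$, $\langle\cdot|\cdot\rangle^u$ are the ultraproducts of the norms and inner products of the $H_N$ (with values in $\mathbb{C}^{u}=\mathbb{C}^{\omega}/\mathcal{U}$). Write $u\sim v$ if $\|u-v\|_2^{u}$ is infinitesimal. $H^{m}$ is the set of classes $v/\sim$ with $\|v\|_2^u$ bounded by a natural number; it is a Hilbert space with $\langle u|v\rangle$ the complex number infinitely close to $\langle u|v\rangle^u$. $A^{m}$ and $A^{*m}$ are the operators on $H^m$ induced by $(A_N)_N$ and $(A_N^{*})_N$. $G^{m}:H\to H^{m}$ is given by $G^{m}(P(A,A^{*})(\phi))=(P(A,A^{*})(\phi))_{N<\omega}/\mathcal{U}/\sim$ (this makes sense because $P(A,A^* )(\phi)\in H_N$ for all large $N$), extended to all of $H$ by continuity. $H^{Im}$ is the range of $G^{m}$. *)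

(* Defs.v *)
From HB Require Import structures.
From mathcomp Require Import all_boot all_order all_algebra.
From mathcomp Require Import complex.
From mathcomp Require Import boolp classical_sets functions cardinality filter.
From mathcomp Require Import reals interval_inference topology normedtype sequences.
From mathcomp Require Import ring lra.

Set Implicit Arguments.
Unset Strict Implicit.
Unset Printing Implicit Defensive.
Import Order.TTheory GRing.Theory Num.Theory.
Import numFieldNormedType.Exports.

Local Open Scope classical_set_scope.
Local Open Scope complex_scope.
Local Open Scope ring_scope.

Section CauchySchwarz.
Context {C : numClosedFieldType} {H : lmodType C} (ip : H -> H -> C).
Hypothesis ipDr : forall x y z, ip x (y + z) = ip x y + ip x z.
Hypothesis ipZr : forall a x y, ip x (a *: y) = a * ip x y.
Hypothesis ip_conj : forall x y, ip y x = Num.conj (ip x y).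
Hypothesis ip_ge0 : forall x, 0 <= ip x x.
Hypothesis ip_eq0 : forall x, ip x x = 0 -> x = 0.

Lemma ip_addl x y z : ip (x + y) z = ip x z + ip y z.
Proof. by rewrite ip_conj ipDr rmorphD/= -!ip_conj. Qed.

Lemma ip_scalel a x y : ip (a *: x) y = Num.conj a * ip x y.
Proof. by rewrite ip_conj ipZr rmorphM/= -ip_conj. Qed.

Lemma ip_CauchySchwarz x y : `|ip x y| ^+ 2 <= ip x x * ip y y.
Proof.
have [/eqP yy0|yy0] := boolP (ip y y == 0).
  rewrite (ip_eq0 yy0) -(scale0r (0 : H)) !ipZr !mul0r mulr0.
  by rewrite normr0 expr0n.
have yy_gt0 : 0 < ip y y by rewrite lt_def yy0 ip_ge0.
pose a := - (ip y x / ip y y).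
have := ip_ge0 (x + a *: y).
rewrite ipDr !ip_addl ipZr ipZr !ip_scalel /a rmorphN/= fmorph_div/=.
rewrite -(ip_conj y y) (ip_conj x y) conjCK.
set z := ip x y; set u := ip y y; rewrite -/u in yy0 yy_gt0.
have -> : ip x x + - (z / u) * Num.conj z +
  (- (Num.conj z / u) * z + - (Num.conj z / u) * (- (z / u) * u)) =
  (ip x x * u - z * Num.conj z) / u by field.
by rewrite pmulr_lge0 ?invr_gt0// subr_ge0 normCK.
Qed.
End CauchySchwarz.

(* The inner product is linear in its second argument; the norm of a module
   over R[i] takes its values in R[i]. *)
HB.mixin Record NormedModule_hasInner (R : realType) H & NormedModule R[i] H := {
  inner : H -> H -> R[i];
  innerDr : forall x y z, inner x (y + z) = inner x y + inner x z;
  innerZr : forall a x y, inner x (a *: y) = a * inner x y;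
  inner_conj : forall x y, inner y x = Num.conj (inner x y);
  inner_normE : forall x, inner x x = `|x| ^+ 2
}.

#[short(type="innerProductType")]
HB.structure Definition InnerProduct (R : realType) :=
  {H of NormedModule R[i] H & NormedModule_hasInner R H}.

#[short(type="hilbertType")]
HB.structure Definition Hilbert (R : realType) :=
  {H of InnerProduct R H & Complete H}.

HB.factory Record Lmodule_isInnerProduct (R : realType) H & GRing.Lmodule R[i] H := {
  ip : H -> H -> R[i];
  ipDr : forall x y z, ip x (y + z) = ip x y + ip x z;
  ipZr : forall a x y, ip x (a *: y) = a * ip x y;
  ip_conj : forall x y, ip y x = Num.conj (ip x y);
  ip_ge0 : forall x, 0 <= ip x x;
  ip_eq0 : forall x, ip x x = 0 -> x = 0
}.

HB.builders Context (R : realType) H & Lmodule_isInnerProduct R H.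

Let ipDl := ip_addl ipDr ip_conj.
Let ipZl := ip_scalel ipZr ip_conj.
Let ip_CS := ip_CauchySchwarz ipDr ipZr ip_conj ip_ge0 ip_eq0.

Let norm x := sqrtC (ip x x).

Let norm_ge0 x : 0 <= norm x.
Proof. by rewrite sqrtC_ge0 ip_ge0. Qed.

Let normD x y : norm (x + y) <= norm x + norm y.
Proof.
rewrite -(ler_pXn2r (ltn0Sn 1)) ?nnegrE ?addr_ge0// sqrrD !sqrtCK.
rewrite ipDr !ipDl (ip_conj x y).
have CS : `|ip x y| <= norm x * norm y.
  rewrite -(ler_pXn2r (ltn0Sn 1)) ?nnegrE ?mulr_ge0//.
  by rewrite exprMn !sqrtCK ip_CS.
have -> : ip x x + Num.conj (ip x y) + (ip x y + ip y y) =
  ip x x + (ip x y + Num.conj (ip x y)) + ip y y by ring.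
rewrite lerD2r lerD2l.
have -> : ip x y + Num.conj (ip x y) = 'Re (ip x y) *+ 2.
  by rewrite [X in X + Num.conj X]Crect conjC_rect ?Creal_Re ?Creal_Im//; ring.
rewrite lerMn2r/=; apply: le_trans CS.
exact: (leif_Re_Creal _).1.
Qed.

Let normZ (l : R[i]) x : norm (l *: x) = `|l| * norm x.
Proof.
rewrite /norm ipZr ipZl mulrA -normCK sqrtCM ?nnegrE ?exprn_ge0 ?ip_ge0//.
by rewrite sqrCK.
Qed.

Let norm_eq0 x : norm x = 0 -> x = 0.
Proof. by move/eqP; rewrite sqrtC_eq0 => /eqP /ip_eq0. Qed.

HB.instance Definition _ := Lmodule_isNormed.Build R[i] H normD normZ norm_eq0.

Let ip_norm (x : H) : ip x x = `|x| ^+ 2.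
Proof. by rewrite sqrtCK. Qed.

HB.instance Definition _ :=
  NormedModule_hasInner.Build R H ipDr ipZr ip_conj ip_norm.
HB.end.

Section InnerTheory.
Context {R : realType} {H : innerProductType R}.
Implicit Types x y z : H.

Lemma innerDl x y z : inner (x + y) z = inner x z + inner y z.
Proof. exact: (ip_addl innerDr inner_conj). Qed.

Lemma innerZl a x y : inner (a *: x) y = Num.conj a * inner x y.
Proof. exact: (ip_scalel innerZr inner_conj). Qed.

Lemma inner_ge0 x : 0 <= inner x x.
Proof. by rewrite inner_normE exprn_ge0. Qed.

Lemma inner_eq0 x : inner x x = 0 -> x = 0.
Proof. by move/eqP; rewrite inner_normE expf_eq0 normr_eq0 => /eqP. Qed.

Lemma innerBr x y z : inner x (y - z) = inner x y - inner x z.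
Proof. by rewrite -scaleN1r innerDr innerZr mulN1r. Qed.

Lemma innerBl x y z : inner (x - y) z = inner x z - inner y z.
Proof. by rewrite -scaleN1r innerDl innerZl rmorphN1 mulN1r. Qed.

Lemma le_norm_inner x y : `|inner x y| <= `|x| * `|y|.
Proof.
rewrite -(ler_pXn2r (ltn0Sn 1)) ?nnegrE ?mulr_ge0//.
rewrite exprMn -!inner_normE.
exact: (ip_CauchySchwarz innerDr innerZr inner_conj inner_ge0 inner_eq0).
Qed.
End InnerTheory.

Section Span.
Context {K : nzRingType} {V : lmodType K}.

Definition linspan (S : set V) : set V :=
  [set v | exists n (c : 'I_n -> K) (s : 'I_n -> V),
     (forall i, S (s i)) /\ v = \sum_i c i *: s i].

Definition span_pred (S : set V) : {pred V} := [pred v | v \in linspan S].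

Lemma span_submod_closed (S : set V) : submod_closed (span_pred S).
Proof.
split=> [|a u v]; rewrite !inE.
  exists 0%N, (fun=> 0), (fun=> 0); split; first by case.
  by rewrite big_ord0.
move=> [m [c [s [Ss ->]]]] [n [d [t [St ->]]]].
exists (m + n)%N.
exists (fun i => match fintype.split i with inl j => a * c j | inr j => d j end).
exists (fun i => match fintype.split i with inl j => s j | inr j => t j end).
split=> [i|]; first by case: (fintype.split i).
rewrite big_split_ord/= scaler_sumr; congr (_ + _); apply: eq_bigr => i _.
  by rewrite (unsplitK (inl i)) scalerA.
by rewrite (unsplitK (inr i)).
Qed.

HB.instance Definition _ (S : set V) :=
  GRing.isSubmodClosed.Build K V (span_pred S) (span_submod_closed S).

Record span_type (S : set V) :=
  SpanVec { span_val :> V; _ : span_val \in span_pred S }.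

HB.instance Definition _ (S : set V) := [isSub for @span_val S].
HB.instance Definition _ (S : set V) := [Choice of span_type S by <:].
HB.instance Definition _ (S : set V) :=
  [SubChoice_isSubLmodule of span_type S by <:].
End Span.

Section SpanInner.
Context {R : realType} {V : innerProductType R} (S : set V).
Implicit Types x y z : span_type S.

Let ip x y : R[i] := inner (val x) (val y).

Let ipDr x y z : ip x (y + z) = ip x y + ip x z.
Proof. by rewrite /ip raddfD innerDr. Qed.

Let ipZr a x y : ip x (a *: y) = a * ip x y.
Proof. by rewrite /ip linearZ innerZr. Qed.

Let ip_conj x y : ip y x = Num.conj (ip x y).
Proof. exact: inner_conj. Qed.

Let ip_ge0 x : 0 <= ip x x.
Proof. by rewrite /ip inner_normE exprn_ge0. Qed.

Let ip_eq0 x : ip x x = 0 -> x = 0.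
Proof.
move/eqP; rewrite /ip inner_normE expf_eq0 normr_eq0 => /eqP x0.
exact: val_inj.
Qed.

HB.instance Definition _ := Lmodule_isInnerProduct.Build R (span_type S)
  ipDr ipZr ip_conj ip_ge0 ip_eq0.
End SpanInner.

(* As ufilter_ge shows, the divisibility condition forces the ultrafilter to be
   nonprincipal. *)
Record square_ultrafilter := SquareUltrafilter {
  ufilter : set_system nat;
  ufilter_ultra : UltraFilter ufilter;
  ufilter_square : forall m : nat, (1 <= m)%N ->
    ufilter [set N | (1 <= N)%N /\ exists2 k, (N = k ^ 2)%N & (m %| k)%N]
}.
#[global] Existing Instance ufilter_ultra.

Lemma ufilter_ge (U : square_ultrafilter) n : ufilter U [set N | (n <= N)%N].
Proof.
apply: filterS (@ufilter_square U n.+1 isT) => N [N1 [k NE nk]] /=.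
have k0 : (0 < k)%N by rewrite lt0n; apply: contraL N1 => /eqP k0; rewrite NE k0.
rewrite NE (leq_trans _ (leq_pmulr k k0))//.
by rewrite (leq_trans _ (dvdn_leq k0 nk)).
Qed.

Section Ultraproduct.
Variable U : square_ultrafilter.

Definition ultra_eq (T : nat -> Type) (u v : {classic forall N, T N}) : bool :=
  `[< ufilter U [set N | u N = v N] >].

Lemma ultra_eq_refl T : reflexive (@ultra_eq T).
Proof. by move=> u; apply/asboolP; apply: filterE. Qed.

Lemma ultra_eq_sym T : symmetric (@ultra_eq T).
Proof.
by move=> u v; apply/asboolP/asboolP; apply: filterS => N /= ->.
Qed.

Lemma ultra_eq_trans T : transitive (@ultra_eq T).
Proof.
move=> v u w /asboolP uv /asboolP vw; apply/asboolP.
by apply: filterS2 uv vw => N /= -> ->.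
Qed.

Canonical ultra_equiv T := EquivRel (@ultra_eq T)
  (@ultra_eq_refl T) (@ultra_eq_sym T) (@ultra_eq_trans T).

Definition ultraprod (T : nat -> Type) : Type := {eq_quot @ultra_eq T}%qT.
HB.instance Definition _ T := Choice.on (ultraprod T).
HB.instance Definition _ T : EqQuotient _ (@ultra_eq T) (ultraprod T) :=
  EqQuotient.on (ultraprod T).

Definition ucls (T : nat -> Type) (u : forall N, T N) : ultraprod T :=
  \pi_(ultraprod T)%qT u.

Definition urep (T : nat -> Type) (x : ultraprod T) : forall N, T N :=
  repr x.

(* umap, umap2 and uholds are the ultraproducts of unary and binary operations
   and of a predicate; the choice of representatives is immaterial by umapE,
   umap2E and uholdsE. *)
Definition umap (T1 T2 : nat -> Type) (f : forall N, T1 N -> T2 N)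
  (x : ultraprod T1) : ultraprod T2 := ucls (fun N => f N (urep x N)).

Definition umap2 (T1 T2 T3 : nat -> Type) (f : forall N, T1 N -> T2 N -> T3 N)
  (x : ultraprod T1) (y : ultraprod T2) : ultraprod T3 :=
  ucls (fun N => f N (urep x N) (urep y N)).

Definition uholds (T : nat -> Type) (P : forall N, T N -> Prop)
  (x : ultraprod T) : Prop := ufilter U [set N | P N (urep x N)].

Lemma uclsP T (u v : forall N, T N) :
  ucls u = ucls v <-> ufilter U [set N | u N = v N].
Proof.
split=> [/eqP|uv]; first by rewrite [_ == _]piE => /asboolP.
by apply/eqP; rewrite [_ == _]piE; apply/asboolP.
Qed.

Lemma urepK T (x : ultraprod T) : ucls (urep x) = x.
Proof. exact: reprK. Qed.

Lemma urep_cls T (u : forall N, T N) : ufilter U [set N | urep (ucls u) N = u N].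
Proof. by apply/uclsP; exact: urepK. Qed.

Lemma umapE T1 T2 (f : forall N, T1 N -> T2 N) u :
  umap f (ucls u) = ucls (fun N => f N (u N)).
Proof. by apply/uclsP; apply: filterS (urep_cls u) => N /= ->. Qed.

Lemma umap2E T1 T2 T3 (f : forall N, T1 N -> T2 N -> T3 N) u v :
  umap2 f (ucls u) (ucls v) = ucls (fun N => f N (u N) (v N)).
Proof.
by apply/uclsP; apply: filterS2 (urep_cls u) (urep_cls v) => N /= -> ->.
Qed.

Lemma uholdsE T (P : forall N, T N -> Prop) u :
  uholds P (ucls u) <-> ufilter U [set N | P N (u N)].
Proof.
by split; apply: filterS2 (urep_cls u) => N /= ->.
Qed.

Lemma uclsW T (P : ultraprod T -> Prop) : (forall u, P (ucls u)) -> forall x, P x.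
Proof. by move=> Pu x; rewrite -[x]urepK. Qed.
End Ultraproduct.

Section UltraComplex.
Context {R : realType} (U : square_ultrafilter).

Definition ucomplex : Type := ultraprod U (fun=> R[i]).
Implicit Types z : ucomplex.

Definition infinitesimal z : Prop :=
  forall e : R, 0 < e -> uholds (fun _ w => `|w| < e%:C) z.

Definition ubounded z : Prop :=
  exists n : nat, uholds (fun _ w => `|w| <= n%:R) z.

(* The standard c is infinitely close to z. *)
Definition uclose z (c : R[i]) : Prop := infinitesimal (umap (fun _ w => w - c) z).

Definition std z : R[i] := xget 0 [set c | uclose z c].

End UltraComplex.

Section Ultraspace.
Context {R : realType} (U : square_ultrafilter) (E : nat -> innerProductType R).

Definition ultraspace : Type := ultraprod U E.
HB.instance Definition _ := Choice.on ultraspace.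
Implicit Types x y z : ultraspace.

Definition uzero : ultraspace := ucls U (fun N => 0 : E N).
Definition uopp : ultraspace -> ultraspace := umap (fun N (x : E N) => - x).
Definition uadd : ultraspace -> ultraspace -> ultraspace :=
  umap2 (fun N (x y : E N) => x + y).
Definition uscale (a : R[i]) : ultraspace -> ultraspace :=
  umap (fun N (x : E N) => a *: x).

Let uaddA : associative uadd.
Proof.
elim/uclsW=> u; elim/uclsW=> v; elim/uclsW=> w; rewrite /uadd !umap2E.
by congr ucls; apply: functional_extensionality_dep => N; rewrite addrA.
Qed.

Let uaddC : commutative uadd.
Proof.
elim/uclsW=> u; elim/uclsW=> v; rewrite /uadd !umap2E.
by congr ucls; apply: functional_extensionality_dep => N; rewrite addrC.
Qed.

Let uadd0 : left_id uzero uadd.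
Proof.
elim/uclsW=> u; rewrite /uadd umap2E.
by congr ucls; apply: functional_extensionality_dep => N; rewrite add0r.
Qed.

Let uaddN : left_inverse uzero uopp uadd.
Proof.
elim/uclsW=> u; rewrite /uadd /uopp umapE umap2E.
by congr ucls; apply: functional_extensionality_dep => N; rewrite addNr.
Qed.

HB.instance Definition _ :=
  GRing.isZmodule.Build ultraspace uaddA uaddC uadd0 uaddN.

Let uscaleA a b x : uscale a (uscale b x) = uscale (a * b) x.
Proof.
elim/uclsW: x => u; rewrite /uscale !umapE.
by congr ucls; apply: functional_extensionality_dep => N; rewrite scalerA.
Qed.

Let uscale1 : left_id 1 uscale.
Proof.
elim/uclsW => u; rewrite /uscale !umapE.
by congr ucls; apply: functional_extensionality_dep => N; rewrite scale1r.
Qed.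

Let uscaleDr : right_distributive uscale +%R.
Proof.
move=> a; elim/uclsW=> u; elim/uclsW=> v.
rewrite /uscale /GRing.add/= /uadd !(umapE, umap2E).
by congr ucls; apply: functional_extensionality_dep => N; rewrite scalerDr.
Qed.

Let uscaleDl x : {morph uscale^~ x : a b / a + b}.
Proof.
elim/uclsW: x => u a b.
rewrite /uscale [in RHS]/GRing.add/= /uadd !(umapE, umap2E).
by congr ucls; apply: functional_extensionality_dep => N; rewrite scalerDl.
Qed.

HB.instance Definition _ := GRing.Zmodule_isLmodule.Build R[i] ultraspace
  uscaleA uscale1 uscaleDr uscaleDl.

Definition uvec (u : forall N, E N) : ultraspace := ucls U u.

Lemma uaddE u v : uvec u + uvec v = uvec (fun N => u N + v N).
Proof. exact: umap2E. Qed.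

Lemma uoppE u : - uvec u = uvec (fun N => - u N).
Proof. exact: umapE. Qed.

Lemma usubE u v : uvec u - uvec v = uvec (fun N => u N - v N).
Proof. by rewrite uoppE uaddE. Qed.

Lemma uscaleE a u : a *: uvec u = uvec (fun N => a *: u N).
Proof. exact: umapE. Qed.

Definition unorm : ultraspace -> ucomplex U := umap (fun N (x : E N) => `|x|).

Definition uinner : ultraspace -> ultraspace -> ucomplex U :=
  umap2 (fun N (x y : E N) => inner x y).

Lemma unorm_smallP u : infinitesimal (unorm (uvec u)) <->
  forall e : R, 0 < e -> ufilter U [set N | `|u N| < e%:C].
Proof.
rewrite /unorm umapE; split=> h e /h; rewrite uholdsE;
  by apply: filterS => N /=; rewrite normr_id.
Qed.

Lemma unorm_boundedP u : ubounded (unorm (uvec u)) <->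
  exists n : nat, ufilter U [set N | `|u N| <= n%:R].
Proof.
rewrite /unorm umapE; split=> -[n h]; exists n; move: h; rewrite uholdsE;
  by apply: filterS => N /=; rewrite normr_id.
Qed.
End Ultraspace.

Section FilterLimit.
Context {K : numFieldType} (F : set_system nat) {FF : ProperFilter F}.
Implicit Types (z w : nat -> K) (c d : K).

Definition flim z c : Prop := forall e : K, 0 < e -> F [set N | `|z N - c| < e].

Lemma flimP z c : flim z c <-> z @ F --> c.
Proof.
split=> [h|/cvgrPdist_lt h e e0].
  by apply/cvgrPdist_lt => e e0; apply: filterS (h _ e0) => N /=; rewrite distrC.
by apply: filterS (h e e0) => N /=; rewrite distrC.
Qed.

Lemma flim_unique z c d : flim z c -> flim z d -> c = d.
Proof. by move=> /flimP zc /flimP; apply: cvg_unique zc. Qed.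

Lemma flimD z w c d : flim z c -> flim w d -> flim (fun N => z N + w N) (c + d).
Proof. by move=> /flimP zc /flimP wd; apply/flimP; exact: cvgD. Qed.

Lemma flimM z w c d : flim z c -> flim w d -> flim (fun N => z N * w N) (c * d).
Proof. by move=> /flimP zc /flimP wd; apply/flimP; exact: cvgM. Qed.
End FilterLimit.

Section UltraLimit.
Context {R : realType} (U : square_ultrafilter).
Implicit Types (z w : nat -> R[i]) (c d : R[i]).

Definition ulim z c : Prop :=
  forall e : R, 0 < e -> ufilter U [set N | `|z N - c| < e%:C].

Lemma ucloseP z c : uclose (ucls U z) c <-> ulim z c.
Proof. by rewrite /uclose umapE; split=> h e /h; rewrite uholdsE. Qed.

Lemma ltr0C (e : R) : (0 < e%:C) = (0 < e).
Proof. exact: (ltcR 0 e). Qed.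

Lemma pos_complexP (e : R[i]) : 0 < e -> exists2 d : R, 0 < d & e = d%:C.
Proof.
move=> e0; have /complex_realP[d ed] : e \is Num.real by rewrite gtr0_real.
by exists d; move: e0; rewrite ed// ltr0C.
Qed.

Lemma ulimP z c : ulim z c <-> flim (ufilter U) z c.
Proof.
split=> [h e /pos_complexP[d d0 ->]|h e e0]; first exact: h.
by apply: h; rewrite ltr0C.
Qed.

Lemma ulim_unique z c d : ulim z c -> ulim z d -> c = d.
Proof. by rewrite !ulimP; exact: flim_unique. Qed.

Lemma std_ulim z c : ulim z c -> std (ucls U z) = c.
Proof.
move=> zc; rewrite /std; case: xgetP => [d _ /ucloseP zd|/(_ c)].
  exact: ulim_unique zd zc.
by case; apply/ucloseP.
Qed.

Lemma ulimD z w c d : ulim z c -> ulim w d -> ulim (fun N => z N + w N) (c + d).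
Proof. by rewrite !ulimP; exact: flimD. Qed.

Lemma ulimM z w c d : ulim z c -> ulim w d -> ulim (fun N => z N * w N) (c * d).
Proof. by rewrite !ulimP; exact: flimM. Qed.

Lemma ulim_cst c : ulim (fun=> c) c.
Proof. by move=> e e0; apply: filterE => N /=; rewrite subrr normr0 ltr0C. Qed.

Lemma ulimZ (a : R[i]) z c : ulim z c -> ulim (fun N => a * z N) (a * c).
Proof. exact/ulimM/ulim_cst. Qed.

Lemma ulim_conj z c : ulim z c -> ulim (fun N => Num.conj (z N)) (Num.conj c).
Proof.
move=> zc e /zc; apply: filterS => N /=.
by rewrite -rmorphB/= norm_conjC.
Qed.

Lemma ulim_near z w c : ufilter U [set N | z N = w N] -> ulim z c -> ulim w c.
Proof. by move=> zw zc e /zc; apply: filterS2 zw => N /= ->. Qed.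

Lemma ulim_squeeze z (w : nat -> R[i]) :
  ufilter U [set N | `|z N| <= w N] -> ulim w 0 -> ulim z 0.
Proof.
move=> zw w0 e /w0; apply: filterS2 zw => N /= zw.
by rewrite !subr0; apply: le_lt_trans; rewrite (le_trans zw)// real_ler_norm// (ger0_real (le_trans _ zw)).
Qed.

Lemma bounded_real_ulim (x : nat -> R) (a b : R) :
  ufilter U [set N | a <= x N <= b] ->
  exists2 r, a <= r <= b & ulim (fun N => (x N)%:C) r%:C.
Proof.
move=> xab; have := @segment_compact R a b; rewrite compact_ultra.
move=> /(_ (x @ ufilter U)) [].
- split; first exact: fmap_proper_filter.
  move=> G GP xG; rewrite eqEsubset; split=> // A GA.
  have [//|] := in_ultra_setVsetC (x @^-1` A) (@ufilter_ultra U).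
  rewrite preimage_setC => /xG nGA.
  by have /filter_ex[? []] : G (A `&` ~` A) by exact: filterI.
- by apply: filterS xab => N /=; rewrite in_itv.
- move=> r [/=]; rewrite in_itv/= => rab xr; exists r => // e e0.
  move/cvgrPdist_lt : xr => /(_ e e0); apply: filterS => N /=.
  by rewrite -rmorphB/= normc_def/= expr0n/= addr0 sqrtr_sqr ltcR distrC.
Qed.

Lemma bounded_ulim z n : ufilter U [set N | `|z N| <= n%:R] ->
  exists c, ulim z c.
Proof.
move=> zn.
have rez N : `|z N| <= n%:R -> - n%:R <= complex.Re (z N) <= n%:R.
  rewrite -ler_norml => h; rewrite -lecR; apply: le_trans (normc_ge_Re _) _.
  by rewrite rmorph_nat.
have imz N : `|z N| <= n%:R -> - n%:R <= complex.Im (z N) <= n%:R.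
  rewrite -ler_norml => h; rewrite -lecR.
  rewrite (le_trans _ (_ : n%:R <= _))//; last by rewrite rmorph_nat.
  apply: le_trans h; rewrite normc_def lecR -[leLHS]sqrtr_sqr ler_wsqrtr//.
  by rewrite lerDr sqr_ge0.
have [a _ za] := bounded_real_ulim (filterS rez zn).
have [b _ zb] := bounded_real_ulim (filterS imz zn).
exists (a%:C + 'i%C * b%:C).
apply: ulim_near (ulimD za (ulimZ 'i%C zb)); apply: filterE => N /=.
by rewrite -complexE.
Qed.

End UltraLimit.

Section MetricUltraproduct.
Context {R : realType} (U : square_ultrafilter) (E : nat -> innerProductType R).

Definition bounded_pred : {pred ultraspace U E} :=
  [pred x | `[< ubounded (unorm x) >]].

Lemma bounded_predP u : uvec U u \in bounded_pred <->
  exists n : nat, ufilter U [set N | `|u N| <= n%:R].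
Proof. by rewrite -unorm_boundedP; split=> [/asboolP|?]//; apply/asboolP. Qed.

Lemma bounded_submod_closed : submod_closed bounded_pred.
Proof.
split=> [|a].
  apply/(@bounded_predP (fun N => 0)); exists 0%N.
  by apply: filterE => N /=; rewrite normr0.
elim/uclsW=> u; elim/uclsW=> v.
move=> /bounded_predP[m um] /bounded_predP[n vn].
rewrite -[ucls U u]/(uvec U u) -[ucls U v]/(uvec U v) uscaleE uaddE.
pose k := (Num.trunc (Num.sqrt (complex.Re a ^+ 2 + complex.Im a ^+ 2))).+1.
have ak : `|a| <= k%:R.
  rewrite normc_def -(rmorph_nat (real_complex R)) lecR ltW//.
  exact: truncnS_gt.
apply/bounded_predP; exists (k * m + n)%N; apply: filterS2 um vn => N /= um vn.
rewrite natrD natrM (le_trans (ler_normD _ _))// lerD// normrZ.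
by rewrite ler_pM.
Qed.

HB.instance Definition _ := GRing.isSubmodClosed.Build R[i] (ultraspace U E)
  bounded_pred bounded_submod_closed.

Record bounded_ultraspace :=
  BoundedVec { bvec :> ultraspace U E; _ : bvec \in bounded_pred }.

HB.instance Definition _ := [isSub for bvec].
HB.instance Definition _ := [Choice of bounded_ultraspace by <:].
HB.instance Definition _ :=
  [SubChoice_isSubLmodule of bounded_ultraspace by <:].

Definition infinitesimal_pred : {pred bounded_ultraspace} :=
  [pred x | `[< infinitesimal (unorm (val x)) >]].

Lemma infinitesimal_predP x u : val x = uvec U u ->
  x \in infinitesimal_pred <-> ulim U (fun N => `|u N|) 0.
Proof.
move=> xu; have -> : (x \in infinitesimal_pred) = `[< infinitesimal (unorm (val x)) >].
  by [].
rewrite xu; split=> [/asboolP/unorm_smallP h|h].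
  by move=> e /h; apply: filterS => N /=; rewrite subr0 normr_id.
apply/asboolP/unorm_smallP => e /h.
by apply: filterS => N /=; rewrite subr0 normr_id.
Qed.

Lemma infinitesimal_submod_closed : submod_closed infinitesimal_pred.
Proof.
split=> [|a x y].
  apply/(@infinitesimal_predP _ (fun N => 0)); first by rewrite raddf0.
  by move=> e e0; apply: filterE => N /=; rewrite normr0 subrr normr0 ltr0C.
have xE : val x = uvec U (urep (val x)) by rewrite /uvec urepK.
have yE : val y = uvec U (urep (val y)) by rewrite /uvec urepK.
move=> /(infinitesimal_predP xE) x0 /(infinitesimal_predP yE) y0.
have axyE : val (a *: x + y) =
    uvec U (fun N => a *: urep (val x) N + urep (val y) N).
  by rewrite linearP/= [X in a *: X]xE [X in _ + X]yE uscaleE uaddE.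
apply/(infinitesimal_predP axyE).
apply: (@ulim_squeeze _ _ _ (fun N => `|a| * `|urep (val x) N| + `|urep (val y) N|)).
  by apply: filterE => N /=; rewrite normr_id (le_trans (ler_normD _ _))// normrZ.
rewrite -(addr0 0) -[in X in X + _](mulr0 `|a|).
by apply: ulimD => //; exact: ulimZ.
Qed.

HB.instance Definition _ := GRing.isSubmodClosed.Build R[i] bounded_ultraspace
  infinitesimal_pred infinitesimal_submod_closed.

(* The quotient identifies x and y when unorm (x - y) is infinitesimal. *)
Definition mspace : Type := {ideal_quot infinitesimal_pred}.
HB.instance Definition _ := Choice.on mspace.
HB.instance Definition _ : EqQuotient _ _ mspace := EqQuotient.on mspace.
HB.instance Definition _ := GRing.Zmodule.on mspace.

Definition mcls (x : bounded_ultraspace) : mspace := \pi_(mspace)%qT x.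
Definition mrep (x : mspace) : bounded_ultraspace := repr x.
Definition mscale (a : R[i]) (x : mspace) : mspace := mcls (a *: mrep x).
Definition minner (x y : mspace) : R[i] :=
  std (uinner (val (mrep x)) (val (mrep y))).

Lemma mclsP x y : mcls x = mcls y <-> x - y \in infinitesimal_pred.
Proof.
split=> [/eqP|h]; first by rewrite [_ == _]piE.
by apply/eqP; rewrite [_ == _]piE.
Qed.

Lemma mrepK x : mcls (mrep x) = x.
Proof. exact: reprK. Qed.

Lemma mrep_cls x : mrep (mcls x) - x \in infinitesimal_pred.
Proof. by apply/mclsP; exact: mrepK. Qed.

Lemma mclsD x y : mcls (x + y) = mcls x + mcls y.
Proof. by rewrite /mcls piE. Qed.

Lemma mclsW (P : mspace -> Prop) : (forall x, P (mcls x)) -> forall x, P x.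
Proof. by move=> Px x; rewrite -[x]mrepK. Qed.

Lemma mscaleE a x : mscale a (mcls x) = mcls (a *: x).
Proof. by apply/mclsP; rewrite -scalerBr rpredZ// mrep_cls. Qed.

Let mscaleA a b x : mscale a (mscale b x) = mscale (a * b) x.
Proof. by elim/mclsW: x => x; rewrite !mscaleE scalerA. Qed.

Let mscale1 : left_id 1 mscale.
Proof. by elim/mclsW => x; rewrite mscaleE scale1r. Qed.

Let mscaleDr : right_distributive mscale +%R.
Proof.
move=> a; elim/mclsW => x; elim/mclsW => y.
by rewrite -mclsD !mscaleE -mclsD scalerDr.
Qed.

Let mscaleDl x : {morph mscale^~ x : a b / a + b}.
Proof. by elim/mclsW: x => x a b; rewrite !mscaleE -mclsD scalerDl. Qed.

HB.instance Definition _ := GRing.Zmodule_isLmodule.Build R[i] mspace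
  mscaleA mscale1 mscaleDr mscaleDl.

Lemma mclsZ a x : mcls (a *: x) = a *: mcls x.
Proof. by rewrite -mscaleE. Qed.

Lemma mclsB x y : mcls (x - y) = mcls x - mcls y.
Proof. by rewrite -scaleN1r mclsD mclsZ scaleN1r. Qed.

Definition brep (x : bounded_ultraspace) : forall N, E N := urep (val x).

Lemma brepK x : uvec U (brep x) = val x.
Proof. exact: urepK. Qed.

Lemma brep_bounded x : exists n : nat, ufilter U [set N | `|brep x N| <= n%:R].
Proof. by apply/bounded_predP; rewrite brepK; exact: valP. Qed.

Lemma brep_eq x u : val x = uvec U u -> ufilter U [set N | brep x N = u N].
Proof. by move=> xu; apply/uclsP; rewrite -/(uvec U _) brepK. Qed.

Lemma brepD x y : ufilter U [set N | brep (x + y) N = brep x N + brep y N].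
Proof. by apply: brep_eq; rewrite raddfD/= -uaddE !brepK. Qed.

Lemma brepB x y : ufilter U [set N | brep (x - y) N = brep x N - brep y N].
Proof. by apply: brep_eq; rewrite raddfB/= -usubE !brepK. Qed.

Lemma brepZ a x : ufilter U [set N | brep (a *: x) N = a *: brep x N].
Proof. by apply: brep_eq; rewrite linearZ/= -uscaleE !brepK. Qed.

Lemma brep_infP x : x \in infinitesimal_pred <-> ulim U (fun N => `|brep x N|) 0.
Proof. by apply: infinitesimal_predP; rewrite brepK. Qed.

Lemma ulim_inner_small x y : x \in infinitesimal_pred ->
  ulim U (fun N => inner (brep x N) (brep y N)) 0 /\
  ulim U (fun N => inner (brep y N) (brep x N)) 0.
Proof.
move=> /brep_infP x0; have [n yn] := brep_bounded y.
have h : ulim U (fun N => n%:R * `|brep x N|) 0.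
  by rewrite -(mulr0 n%:R); exact: ulimZ.
split; apply: ulim_squeeze h; apply: filterS yn => N /= yn.
  by rewrite (le_trans (le_norm_inner _ _))// mulrC ler_wpM2r.
by rewrite (le_trans (le_norm_inner _ _))// ler_wpM2r.
Qed.

Lemma ulim_minner_rep (x y : mspace) :
  ulim U (fun N => inner (brep (mrep x) N) (brep (mrep y) N)) (minner x y).
Proof.
have [m xm] := brep_bounded (mrep x); have [n yn] := brep_bounded (mrep y).
have [|c xyc] := @bounded_ulim R U
    (fun N => inner (brep (mrep x) N) (brep (mrep y) N)) (m * n)%N.
  apply: filterS2 xm yn => N /= xm yn.
  by rewrite natrM (le_trans (le_norm_inner _ _))// ler_pM.
by have /std_ulim := xyc; rewrite /minner => ->.
Qed.

Lemma ulim_minner x y :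
  ulim U (fun N => inner (brep x N) (brep y N)) (minner (mcls x) (mcls y)).
Proof.
set x' := mrep (mcls x); set y' := mrep (mcls y).
have hx := (ulim_inner_small y (mrep_cls x)).1.
have hy := (ulim_inner_small x' (mrep_cls y)).2.
have := ulimD (ulim_minner_rep (mcls x) (mcls y)) (ulimZ (-1) (ulimD hx hy)).
rewrite addr0 mulr0 addr0; apply: ulim_near.
apply: filterS2 (brepB x' x) (brepB y' y) => N /= -> ->.
rewrite innerBl innerBr -/x' -/y'.
by move: (inner _ _) (inner _ _) (inner _ _) => a b c; ring.
Qed.

Let minnerDr x y z : minner x (y + z) = minner x y + minner x z.
Proof.
elim/mclsW: x => x; elim/mclsW: y => y; elim/mclsW: z => z; rewrite -mclsD.
apply: ulim_unique (ulim_minner _ _) _.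
apply: ulim_near (ulimD (ulim_minner x y) (ulim_minner x z)).
by apply: filterS (brepD y z) => N /= ->; rewrite innerDr.
Qed.

Let minnerZr a x y : minner x (a *: y) = a * minner x y.
Proof.
elim/mclsW: x => x; elim/mclsW: y => y; rewrite -mclsZ.
apply: ulim_unique (ulim_minner _ _) _.
apply: ulim_near (ulimZ a (ulim_minner x y)).
by apply: filterS (brepZ a y) => N /= ->; rewrite innerZr.
Qed.

Let minner_conj x y : minner y x = Num.conj (minner x y).
Proof.
elim/mclsW: x => x; elim/mclsW: y => y.
apply: ulim_unique (ulim_minner _ _) _.
apply: ulim_near (ulim_conj (ulim_minner x y)).
by apply: filterE => N /=; rewrite -inner_conj.
Qed.

Lemma ulim_bnorm x :
  exists2 r : R, 0 <= r & ulim U (fun N => `|brep x N|) r%:C.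
Proof.
have [n xn] := brep_bounded x.
have normE N : `|brep x N| = (complex.Re `|brep x N|)%:C.
  by rewrite RRe_real// normr_real.
have [|r /andP[r0 _] xr] :=
    @bounded_real_ulim R U (fun N => complex.Re `|brep x N|) 0 n%:R.
  apply: filterS xn => N /=; rewrite normE lecE/= => /andP[_ h].
  rewrite -ler0c -normE normr_ge0/=; apply: le_trans h _.
  by rewrite -(rmorph_nat (real_complex R))/=.
exists r => //; apply: ulim_near xr; apply: filterE => N /=.
by rewrite -normE.
Qed.

Lemma minner_norm x r : ulim U (fun N => `|brep x N|) r ->
  minner (mcls x) (mcls x) = r ^+ 2.
Proof.
move=> xr; apply: ulim_unique (ulim_minner _ _) _.
apply: ulim_near (ulimM xr xr); apply: filterE => N /=.
by rewrite inner_normE.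
Qed.

Let minner_ge0 x : 0 <= minner x x.
Proof.
elim/mclsW: x => x; have [r r0 /minner_norm->] := ulim_bnorm x.
by rewrite exprn_ge0// ler0c.
Qed.

Let minner_eq0 x : minner x x = 0 -> x = 0.
Proof.
elim/mclsW: x => x; have [r r0 xr] := ulim_bnorm x.
rewrite (minner_norm xr) => /eqP; rewrite expf_eq0/= => /eqP rE.
rewrite rE in xr.
rewrite -(subrr (mcls x)) -mclsB subrr; apply/mclsP; rewrite subr0.
exact/brep_infP.
Qed.

HB.instance Definition _ := Lmodule_isInnerProduct.Build R mspace
  minnerDr minnerZr minner_conj minner_ge0 minner_eq0.

Lemma ulim_inner x y :
  ulim U (fun N => inner (brep x N) (brep y N)) (inner (mcls x) (mcls y)).
Proof. exact: ulim_minner. Qed.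

Lemma ulim_norm x : ulim U (fun N => `|brep x N|) `|mcls x|.
Proof.
have [r r0 xr] := ulim_bnorm x.
suff -> : `|mcls x| = r%:C by [].
apply/eqP; rewrite -(eqrXn2 (ltn0Sn 1)) ?ler0c// -inner_normE.
exact/eqP/minner_norm.
Qed.

End MetricUltraproduct.

Section Completeness.
Context {R : realType} (U : square_ultrafilter) (E : nat -> innerProductType R).
Local Notation mspace := (mspace U E).
Local Notation bvecs := (bounded_ultraspace U E).

(* The class of the sequence u, which is only meaningful for u bounded along U;
   otherwise mvec u = 0. *)
Definition mvec (u : forall N, E N) : mspace := mcls (insubd 0 (uvec U u)).

Lemma brep_insubd u n : ufilter U [set N | `|u N| <= n%:R] ->
  ufilter U [set N | brep (insubd (0 : bvecs) (uvec U u)) N = u N].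
Proof.
move=> un; apply: brep_eq; rewrite insubdK//.
by apply/bounded_predP; exists n.
Qed.

Lemma norm_mcls_lt (x : bvecs) s : `|mcls x| < s ->
  ufilter U [set N | `|brep x N| < s].
Proof.
move=> xs; have : 0 < s - `|mcls x| by rewrite subr_gt0.
move=> /pos_complexP[e e0 eE]; apply: filterS (ulim_norm x e0) => N /=.
rewrite real_ltr_distl ?rpredB ?normr_real// -eE => /andP[_].
by rewrite subrKC.
Qed.

Lemma norm_mcls_le (x : bvecs) s : 0 <= s ->
  ufilter U [set N | `|brep x N| <= s] -> `|mcls x| <= s.
Proof.
move=> s0 xs; rewrite real_leNgt ?normr_real ?ger0_real//; apply/negP => sx.
have : 0 < `|mcls x| - s by rewrite subr_gt0.
move=> /pos_complexP[e e0 eE].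
have : ufilter U set0; last by move/filter_ex => -[].
apply: filterS2 xs (ulim_norm x e0) => N /= xN.
rewrite real_ltr_distl ?rpredB ?normr_real// -eE opprB subrKC.
by move=> /andP[/lt_geF]; rewrite xN.
Qed.

Lemma mspace_complete (F : set_system mspace) :
  ProperFilter F -> cauchy F -> cvg F.
Proof.
move=> FF /cauchyP Fc.
pose eps k : R[i] := 2^-1 ^+ k.
have eps0 k : 0 < eps k by rewrite exprn_gt0// invr_gt0.
have eps_le i k : (i <= k)%N -> eps k <= eps i.
  by move=> ik; apply: ler_wiXn2l => //; rewrite ?invr_ge0// invf_le1// ler1n.
have /choice[x xF] : forall k, exists x, F (ball x (eps k)).
  by move=> k; apply: Fc.
pose u k := mrep (x k).
have uE k : mcls (u k) = x k by exact: mrepK.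
have u_close i k : (i <= k)%N ->
    ufilter U [set N | `|brep (u i) N - brep (u k) N| < eps i *+ 2].
  move=> ik; have [y [yi yk]] : exists y, (ball (x i) (eps i) `&` ball (x k) (eps k)) y.
    by apply: (@filter_ex _ F); exact: filterI.
  have : `|mcls (u i - u k)| < eps i *+ 2.
    rewrite mclsB !uE -[_ - _](subrKA y) mulr2n.
    rewrite (le_lt_trans (ler_normD _ _))// ltrD//.
    rewrite distrC; apply: lt_le_trans (eps_le _ _ ik).
    by move: yk; rewrite -ball_normE.
  move=> /norm_mcls_lt; apply: filterS2 (brepB (u i) (u k)) => N /=.
  by move=> ->.
pose P k N := (k <= N)%N /\
  forall i : 'I_k.+1, `|brep (u i) N - brep (u k) N| < eps i *+ 2.
have PU k : ufilter U [set N | P k N].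
  have h : ufilter U [set N | forall i : 'I_k.+1,
      `|brep (u i) N - brep (u k) N| < eps i *+ 2].
    by apply: filter_forall => i; apply: u_close; rewrite -ltnS.
  by apply: filterS2 (ufilter_ge U k) h => N; split.
have /choice[m mP] : forall N, exists k, P k N /\ forall i, P i N -> (i <= k)%N.
  move=> N; have P0 : exists k, `[< P k N >].
    exists 0%N; apply/asboolP; split=> // i; rewrite ord1 subrr normr0.
    by rewrite pmulrn_lgt0.
  have Pb k : `[< P k N >] -> (k <= N)%N by move/asboolP => -[].
  case: (ex_maxnP P0 Pb) => k /asboolP Pk kmax; exists k; split=> // i Pi.
  by apply: kmax; apply/asboolP.
pose v N := brep (u (m N)) N.
have u_v i : ufilter U [set N | `|brep (u i) N - v N| < eps i *+ 2].
  apply: filterS (PU i) => N /= /(mP N).2 im.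
  have im' : (i < (m N).+1)%N by rewrite ltnS.
  exact: (mP N).1.2 (Ordinal im').
have [n un] := brep_bounded (u 0%N).
have vn : ufilter U [set N | `|v N| <= (n + 2)%:R].
  apply: filterS2 un (u_v 0%N) => N /= un uv.
  rewrite -(subrKC (brep (u 0%N) N) (v N)) natrD.
  rewrite (le_trans (ler_normD _ _))// lerD// distrC ltW//.
have vE := brep_insubd vn.
apply/cvg_ex; exists (mvec v); apply/cvg_ballP => e e0.
have [k ke] : exists k, eps k *+ 3 <= e.
  have [d d0 ->] := pos_complexP e0.
  have d3 : 0 < d / 3 by rewrite divr_gt0.
  have [k _ /(_ k (leqnn k))/ltW kd] := near_infty_natSinv_expn_lt (PosNum d3).
  exists k; rewrite /eps -[leLHS]mulr_natr -ler_pdivlMr ?ltr0n//.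
  have -> : d%:C / 3 = (d / 3)%:C :> R[i].
    by rewrite rmorphM fmorphV/= rmorph_nat.
  have -> : (2^-1 : R[i]) ^+ k = ((2^-1 : R) ^+ k)%:C.
    by rewrite rmorphXn fmorphV/= rmorph_nat.
  rewrite lecR; apply: le_trans kd.
  by rewrite div1r exprVn.
apply: filterS (xF k) => y; rewrite -!ball_normE/= => xy.
rewrite -[_ - _](subrKA (x k)); apply: lt_le_trans ke.
rewrite mulrSr (le_lt_trans (ler_normD _ _))//. apply: ler_ltD => //.
rewrite distrC -uE -mclsB; apply: norm_mcls_le; first by rewrite mulrn_wge0// ltW.
apply: filterS3 (brepB (u k) (insubd 0 (uvec U v))) vE (u_v k) => N /= -> -> /ltW.
by [].
Qed.

HB.instance Definition _ := Uniform_isComplete.Build mspace mspace_complete.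
End Completeness.

Section Operators.
Context {R : realType}.

Definition adjoint_of {E : innerProductType R} (T Ts : E -> E) : Prop :=
  forall u v, inner (Ts u) v = inner u (T v).

(* The restriction of Ts to the subspace S is the adjoint of that of T, both
   being operators on S. *)
Definition adjoint_on {E : innerProductType R} (S : set E) (T Ts : E -> E) :
    Prop :=
  [/\ forall u, S u -> S (T u), forall u, S u -> S (Ts u) &
      forall u v, S u -> S v -> inner (Ts u) v = inner u (T v)].

(* Preservation of the norm follows from that of the inner product. *)
Definition isometric_iso {E F : innerProductType R} (S : set E) (S' : set F)
    (f : E -> F) : Prop :=
  [/\ forall a u v, S u -> S v -> f (a *: u + v) = a *: f u + f v,
      forall u v, S u -> S v -> inner (f u) (f v) = inner u v &
      set_bij S S' f].

Definition unitary {E : innerProductType R} (V : E -> E) : Prop :=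
  isometric_iso setT setT V.

Definition orthocomplement {E : innerProductType R} (S : set E) : set E :=
  [set w | forall v, S v -> inner v w = 0].

Definition separable (T : topologicalType) : Prop :=
  exists2 S : set T, countable S & dense S.

(* {poly {poly R[i]}} is C[X,Y] as C[Y][X]: P`_i`_j is the coefficient of
   X^i Y^j, with A substituted for X and As for Y. *)
Definition poly2_op {V : lmodType R[i]} (P : {poly {poly R[i]}})
    (A As : V -> V) (u : V) : V :=
  \sum_(i < size P) \sum_(j < size P`_i) P`_i`_j *: iter i A (iter j As u).

Definition poly2_orbit {V : lmodType R[i]} (A As : V -> V) (u : V) : set V :=
  [set poly2_op P A As u | P in setT].

Section InducedOperator.
Context (U : square_ultrafilter) {E : nat -> innerProductType R}.

(* See minduced_mvec: for a uniformly bounded family T, the induced operator maps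
   the class of (u_N) to the class of (T_N u_N). *)
Definition uinduced (T : forall N, E N -> E N) (x : ultraspace U E) :
  ultraspace U E := umap T x.

Definition minduced (T : forall N, E N -> E N) (x : mspace U E) : mspace U E :=
  mcls (insubd 0 (uinduced T (val (mrep x)))).

Lemma mvecP (u v : forall N, E N) m n :
  ufilter U [set N | `|u N| <= m%:R] -> ufilter U [set N | `|v N| <= n%:R] ->
  mvec U u = mvec U v <-> ulim U (fun N => `|u N - v N|) 0.
Proof.
move=> um vn; rewrite /mvec mclsP brep_infP.
have h := brepB (insubd 0 (uvec U u)) (insubd 0 (uvec U v)).
have h' : ufilter U [set N |
    `|brep (insubd 0 (uvec U u) - insubd 0 (uvec U v)) N| = `|u N - v N|].
  by apply: filterS3 h (brep_insubd um) (brep_insubd vn) => N /= -> -> ->.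
split; apply: ulim_near => //.
by apply: filterS h' => N /= ->.
Qed.

Lemma mvec_brep (x : bounded_ultraspace U E) : mvec U (brep x) = mcls x.
Proof. by rewrite /mvec brepK valKd. Qed.

Lemma minduced_mvec (T : forall N, E N -> E N) (k m : nat) (u : forall N, E N) :
  (forall N, T N 0 = 0) ->
  (forall N v w, `|T N v - T N w| <= k%:R * `|v - w|) ->
  ufilter U [set N | `|u N| <= m%:R] ->
  minduced T (mvec U u) = mvec U (fun N => T N (u N)).
Proof.
move=> T0 TL um; set x := mrep (mvec U u).
have xu : mvec U (brep x) = mvec U u by rewrite mvec_brep; exact: mrepK.
have [n xn] := brep_bounded x.
have Tb v l : ufilter U [set N | `|v N : E N| <= l%:R] ->
    ufilter U [set N | `|T N (v N)| <= (k * l)%:R].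
  apply: filterS => N /= vl; rewrite -[T N _]subr0 -(T0 N).
  by rewrite (le_trans (TL _ _ _))// subr0 natrM ler_wpM2l.
rewrite /minduced -/x -[uinduced T _]/(uvec U (fun N => T N (brep x N))).
apply/(mvecP (Tb _ _ xn) (Tb _ _ um)).
have h : ulim U (fun N => k%:R * `|brep x N - u N|) 0.
  by rewrite -(mulr0 k%:R); apply: ulimZ; apply/(mvecP xn um).
apply: ulim_squeeze h; apply: filterE => N /=.
by rewrite normr_id.
Qed.
End InducedOperator.
End Operators.

Section Truncations.
Context {R : realType} {H : innerProductType R} (A As : H -> H) (phi : H).

Definition orbit_upto N : set H :=
  [set v | exists i j, [/\ (i <= N)%N, (j <= N)%N &
    v = iter i A (iter j As phi)]].

Definition orbit_upto_minus N : set H :=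
  [set v | exists i j, [/\ (i < N)%N, (j <= N)%N &
    v = iter i A (iter j As phi)]].

Definition orbit_upto_plus N : set H :=
  [set v | exists i j, [/\ (0 < i <= N)%N, (j <= N)%N &
    v = iter i A (iter j As phi)]].

Definition HN N : innerProductType R := span_type (orbit_upto N).

Definition HNminus N : set (HN N) := [set u | linspan (orbit_upto_minus N) (val u)].

Definition HNplus N : set (HN N) := [set u | linspan (orbit_upto_plus N) (val u)].

Definition Wminus N : set (HN N) := orthocomplement (@HNminus N).

Definition Wplus N : set (HN N) := orthocomplement (@HNplus N).

Variable U : square_ultrafilter.

(* The class of the sequence constantly equal to y, with 0 for the N such that
   y is not in H_N. *)
Definition mconst (y : H) : mspace U HN := mvec U (fun N => insubd (0 : HN N) y).

(* Extension by continuity of y |-> mconst y from the dense set of all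
   P(A, As)(phi); see Gm_poly2_op and Gm_continuous. *)
Definition Gm (x : H) : mspace U HN :=
  lim (mconst @ within (poly2_orbit A As phi) (nbhs x)).

Definition HIm : set (mspace U HN) := range Gm.

Lemma poly2_op_HN P : exists n, forall N, (n <= N)%N ->
  poly2_op P A As phi \in span_pred (orbit_upto N).
Proof.
exists (maxn (size P) (\max_(i < size P) size (P`_i)%R)) => N.
rewrite geq_max => /andP[PN /bigmax_leqP PiN].
apply: rpred_sum => i _; apply: rpred_sum => j _; apply: rpredZ.
rewrite inE; exists 1%N, (fun=> 1), (fun=> iter i A (iter j As phi)).
split; last by rewrite big_ord1 scale1r.
move=> _; exists i, j; split=> //.
  by rewrite (leq_trans _ PN)// ltnW.
by rewrite (leq_trans _ (PiN i isT))// ltnW.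
Qed.

Lemma span_normE (S : set H) (u : span_type S) : `|u| = `|val u|.
Proof.
apply/eqP; rewrite -(eqrXn2 (ltn0Sn 1))//; apply/eqP.
by rewrite -!inner_normE.
Qed.

Lemma mconst_bounded y : exists n : nat,
  ufilter U [set N | `|insubd (0 : HN N) y| <= n%:R].
Proof.
exists (Num.trunc (complex.Re `|y|)).+1; apply: filterE => N /=.
rewrite span_normE val_insubd; case: ifP => _; last by rewrite normr0.
rewrite -(RRe_real (normr_real y)) -(rmorph_nat (real_complex R)) lecR ltW//.
exact: truncnS_gt.
Qed.

Lemma orbit_HN w : poly2_orbit A As phi w ->
  ufilter U [set N | w \in span_pred (orbit_upto N)].
Proof.
move=> [P _ <-]; have [n wn] := poly2_op_HN P.
by apply: filterS (ufilter_ge U n) => N; exact: wn.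
Qed.

Lemma mconst_isometric y z : poly2_orbit A As phi y -> poly2_orbit A As phi z ->
  `|mconst y - mconst z| = `|y - z|.
Proof.
move=> yD zD.
have [m ym] := mconst_bounded y; have [n zn] := mconst_bounded z.
rewrite /mconst /mvec -mclsB; apply: ulim_unique (ulim_norm _) _.
apply: ulim_near (ulim_cst U `|y - z|).
have h : ufilter U [set N |
    `|insubd (0 : HN N) y - insubd (0 : HN N) z| = `|y - z|].
  apply: filterS2 (orbit_HN yD) (orbit_HN zD) => N /= yN zN.
  by rewrite span_normE raddfB/= !insubdK.
have hB := brepB (insubd 0 (uvec U (fun N => insubd (0 : HN N) y)))
                 (insubd 0 (uvec U (fun N => insubd (0 : HN N) z))).
apply: filterS2 h _ => [N /= <-|].
  by move: N; exact: (fun N e => e).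
by apply: filterS3 hB (brep_insubd ym) (brep_insubd zn) => N /= -> -> ->.
Qed.

Hypothesis cyclic : dense (poly2_orbit A As phi).
Local Notation D := (poly2_orbit A As phi).

Lemma orbit_close (x : H) (e : R[i]) : 0 < e -> exists2 y, D y & `|x - y| < e.
Proof.
move=> e0; have [y xDy] := cyclic (ex_intro _ x (ballxx x e0)) (ball_open x e).
have [xy Dy] : ball x e y /\ D y := xDy.
by exists y => //; move: xy; rewrite -ball_normE.
Qed.

Lemma within_orbit_proper (x : H) : ProperFilter (within D (nbhs x)).
Proof.
apply: within_nbhs_proper => B; rewrite -nbhs_ballE => -[e /= e0 xeB].
have [y Dy xy] := orbit_close x e0.
by exists y; split=> //; apply: xeB; rewrite -ball_normE.
Qed.

Lemma mconst_within_cvg (x : H) : cvg (mconst @ within D (nbhs x)).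
Proof.
have FF := within_orbit_proper x.
apply: cauchy_cvg; apply/cauchyP => e e0.
have e2 : 0 < e / 2 by rewrite divr_gt0.
have [y Dy xy] := orbit_close x e2.
exists (mconst y).
suff : nbhs x [set z | D z -> ball (mconst y) e (mconst z)] by [].
apply: filterS (nbhsx_ballx x _ e2) => z; rewrite -!ball_normE/= => xz Dz.
rewrite mconst_isometric// -(subrKA x) [e]splitr.
by rewrite (le_lt_trans (ler_normD _ _))// ltrD// distrC.
Qed.

Lemma Gm_dist_orbit (x y : H) : D y -> `|Gm x - mconst y| <= `|x - y|.
Proof.
move=> Dy; have FF := within_orbit_proper x.
apply/ler_addgt0Pr => e e0.
have e2 : 0 < e / 2 by rewrite divr_gt0.
have /cvgrPdist_lt/(_ _ e2) h1 := @mconst_within_cvg x.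
have h2 : within D (nbhs x) [set z | D z /\ `|x - z| < e / 2].
  by apply: filterS (nbhsx_ballx x _ e2) => z; rewrite -ball_normE.
have [z [/= Gz [Dz xz]]] : exists z, ([set z | `|Gm x - mconst z| < e / 2] `&`
    [set z | D z /\ `|x - z| < e / 2]) z.
  by apply: (@filter_ex _ (within D (nbhs x))); exact: filterI.
rewrite -(subrKA (mconst z)) (le_trans (ler_normD _ _))// mconst_isometric//.
rewrite -(subrKA x z) [e]splitr.
rewrite (le_trans (lerD (ltW Gz) (ler_normD _ _)))//.
have /ltW := xz; rewrite distrC => zx.
by rewrite [X in X <= _]addrA addrC lerD2l lerD2l.
Qed.

Lemma Gm_poly2_op P : Gm (poly2_op P A As phi) = mconst (poly2_op P A As phi).
Proof.
apply/eqP; rewrite -subr_eq0 -normr_le0.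
by rewrite (le_trans (Gm_dist_orbit _ _)) ?subrr ?normr0//; exists P.
Qed.

Lemma Gm_continuous : continuous Gm.
Proof.
move=> x; apply/cvgrPdist_le => e e0; near=> z.
have e4 : 0 < e / 4 by rewrite divr_gt0.
have [y Dy xy] := orbit_close x e4.
have xz : `|x - z| < e / 2.
  by near: z; apply: cvgr_dist_lt => //; rewrite divr_gt0.
have zy : `|z - y| <= `|x - z| + `|x - y|.
  by rewrite -(subrKA x z) (le_trans (ler_normD _ _))// distrC.
rewrite -(subrKA (mconst y)); apply: le_trans (ler_normD _ _) _.
rewrite [X in _ + X]distrC.
apply: le_trans (lerD (Gm_dist_orbit x Dy) (Gm_dist_orbit z Dy)) _.
apply: le_trans (lerD (ltW xy) (le_trans zy (lerD (ltW xz) (ltW xy)))) _.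
suff -> : e / 4 + (e / 2 + e / 4) = e by [].
by field.
Unshelve. all: by end_near. Qed.

End Truncations.

Arguments HNminus {R H} A As phi N.
Arguments HNplus {R H} A As phi N.
Arguments Wminus {R H} A As phi N.
Arguments Wplus {R H} A As phi N.
Arguments Gm {R H} A As phi U x.
Arguments HIm {R H} A As phi U.
Arguments minduced {R} U {E} T x.

(* Main.v *)
Require Import Defs.
From HB Require Import structures.
From mathcomp Require Import all_boot all_order all_algebra.
From mathcomp Require Import complex ring.
From mathcomp Require Import boolp classical_sets functions cardinality filter.
From mathcomp Require Import reals topology normedtype sequences.

Set Implicit Arguments.
Unset Strict Implicit.
Unset Printing Implicit Defensive.
Import Order.TTheory GRing.Theory Num.Theory.
Import numFieldNormedType.Exports.

Local Open Scope classical_set_scope.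
Local Open Scope complex_scope.
Local Open Scope ring_scope.

(** Put r = |q|^2 and let D be the orbit of phi under polynomials in A and A*,
    which is dense.

    Since A is q times a unitary, A* A = A A* = r I, so A* moves past powers of A
    and D is the span of the vectors A^i A*^j phi (poly2_orbitE); in particular D
    is stable under A and A* (orbit_A, orbit_As).  A given y in D lies in H_N^-
    for all large N (orbit_minus).

    The decisive point is that each A_N satisfies <A_N u, A_N v> = r <u, v>
    (AN_scales): H_N^- is finite dimensional, so H_N = H_N^- + W^- orthogonally,
    and A_N carries the two summands, scaled by the same factor, to the orthogonal
    pieces H_N^+ and W^+.  Hence A_N* A_N = r I, and A_N, A_N* are bounded by |q|
    uniformly in N.  Consequently the induced operators A^m and A*^m are computed
    on arbitrary representatives, and both the adjunction and the scaling
    relation pass to the ultraproduct (minduced_adjoint, minduced_scales).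

    For y in D and N large, A_N y = A y because y is in H_N^- (AN_eventually), and
    A_N* y = A* y because y = A_N z with z = r^-1 A* y (ANs_eventually).  So A^m
    and A*^m act on the classes of constant sequences from D as A and A* do.

    The map G^m is continuous and on D it is the class of the constant sequence;
    hence its linearity, the preservation of the norm and both intertwining
    relations hold on D and extend by density (Gm_linear, Gm_norm,
    Gm_intertwines).  Polarization gives the inner product.  The intertwining
    relations make the range of G^m stable under A^m and A*^m, so the adjunction
    restricts to it. *)

(** * Continuous maps that agree on a dense set *)

Section Density.
Context {T : topologicalType} {Y : topologicalType} (D : set T).

(** Both maps converge, along the trace on D of the neighbourhoods of x, to their
    values at x, and there they coincide. *)
Lemma dense_eq (f g : T -> Y) : hausdorff_space Y -> dense D ->
  continuous f -> continuous g -> (forall x, D x -> f x = g x) ->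
  forall x, f x = g x.
Proof.
move=> hY dD cf cg fg x.
have FF : ProperFilter (within D (nbhs x)).
  apply: within_nbhs_proper => B; rewrite nbhsE => -[O [oO Ox] OB].
  have [y [Oy Dy]] := dD O (ex_intro _ x Ox) oO.
  by exists y; split=> //; exact: OB.
have fx : f @ within D (nbhs x) --> f x.
  by apply: cvg_trans (cf x); apply: cvg_app; exact: cvg_within.
have gx : g @ within D (nbhs x) --> g x.
  by apply: cvg_trans (cg x); apply: cvg_app; exact: cvg_within.
apply: (cvg_unique hY fx); apply: cvg_trans gx; apply: near_eq_cvg.
apply: filterS (withinT D (nbhs_filter x)) => y Dy; exact/esym/fg.
Qed.
End Density.

Lemma continuous_comb (K : numFieldType) (W : normedModType K)
  (T : topologicalType) (a : K) (f g : T -> W) :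
  continuous f -> continuous g -> continuous (fun t => a *: f t + g t).
Proof.
by move=> cf cg t; apply: cvgD (cg t); apply: cvgZ (cf t); exact: cvg_cst.
Qed.

(** * Linear spans *)

Lemma linspanP (K : nzRingType) (V : lmodType K) (S : set V) v :
  linspan S v <-> v \in span_pred S.
Proof. by rewrite inE. Qed.

Section LinearSpan.
Context {K : nzRingType} {V : lmodType K}.
Implicit Types S T : set V.

Lemma linspan_gen S v : S v -> linspan S v.
Proof.
move=> Sv; exists 1%N, (fun=> 1), (fun=> v); split=> //.
by rewrite big_ord1 scale1r.
Qed.

Lemma linspan_comb S a u v : linspan S u -> linspan S v ->
  linspan S (a *: u + v).
Proof. by rewrite !linspanP => Su Sv; rewrite rpredD ?rpredZ. Qed.

Lemma linspan_map (W : lmodType K) (T : set W) S (f : V -> W) :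
  linear f -> (forall s, S s -> linspan T (f s)) ->
  forall v, linspan S v -> linspan T (f v).
Proof.
move=> lf Sf _ [n [c [s [Ss ->]]]].
pose F : {linear V -> W} := HB.pack f (GRing.isLinear.Build K V W *:%R f lf).
rewrite -[f]/(F : V -> W) linear_sum; apply/linspanP/rpred_sum => i _.
by rewrite linearZ rpredZ//; apply/linspanP; exact: Sf.
Qed.

Lemma linspan_sub S T : (forall s, S s -> T s) -> linspan S `<=` linspan T.
Proof.
by move=> ST v; apply: (linspan_map (f := id)) => // s /ST/linspan_gen.
Qed.

(** A vector of the span of an increasing union uses only finitely many
    generators. *)
Lemma linspan_eventually (S : nat -> set V) v :
  (forall m n s, (m <= n)%N -> S m s -> S n s) ->
  linspan [set s | exists n, S n s] v ->
  exists n, forall N, (n <= N)%N -> linspan (S N) v.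
Proof.
move=> Smono [n [c [s [/choice[m Sm] ->]]]].
exists (\max_i m i) => N /bigmax_leqP mN.
apply/linspanP/rpred_sum => i _; apply/rpredZ/linspanP/linspan_gen.
exact: Smono (mN i isT) (Sm i).
Qed.
End LinearSpan.

(** * Projections, adjoints and scaled isometries *)

Section Inner.
Context {R : realType} {E : innerProductType R}.
Implicit Types (x y z : E) (c : R[i]).

Lemma inner_ext x y : (forall z, inner z x = inner z y) -> x = y.
Proof.
move=> xy; apply/eqP; rewrite -subr_eq0; apply/eqP/inner_eq0.
by rewrite innerBr xy subrr.
Qed.

Lemma inner0r x : inner x 0 = 0.
Proof. by rewrite -(subrr x) innerBr subrr. Qed.

Lemma inner0l x : inner 0 x = 0.
Proof. by rewrite inner_conj inner0r rmorph0. Qed.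

Lemma inner_orthoC x y : inner x y = 0 -> inner y x = 0.
Proof. by move=> xy; rewrite inner_conj xy rmorph0. Qed.

Lemma innerD_ortho x1 x2 y1 y2 : inner x1 y2 = 0 -> inner x2 y1 = 0 ->
  inner (x1 + x2) (y1 + y2) = inner x1 y1 + inner x2 y2.
Proof. by move=> xy yx; rewrite innerDl !innerDr xy yx addr0 add0r. Qed.

Lemma orthocomplement_linspan (S : set E) w :
  orthocomplement S w -> orthocomplement (linspan S) w.
Proof.
move=> Sw v [n [c [s [Ss ->]]]]; elim/big_ind: _ => [|a b aw bw|i _].
- exact: inner0l.
- by rewrite innerDl aw bw addr0.
- by rewrite innerZl Sw ?mulr0.
Qed.

(** Gram-Schmidt: to add a generator a, replace it by its component b orthogonal
    to the previous generators and subtract the projection onto b. *)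
Lemma ortho_projection (S : set E) : finite_set S -> forall x,
  exists2 p, linspan S p & orthocomplement S (x - p).
Proof.
move=> /finite_seqP[s ->]; elim: s => [|a s IH] x.
  by exists 0; first exact/linspanP/rpred0.
have mono : linspan [set` s] `<=` linspan [set` a :: s].
  by apply: linspan_sub => y /= ys; rewrite inE ys orbT.
have [pa sa oa] := IH a; have [px sx ox] := IH x.
set b := a - pa in oa; pose c := inner b x / inner b b.
have opx : inner b px = 0.
  exact/inner_orthoC/(orthocomplement_linspan oa).
exists (c *: b + px).
  apply: linspan_comb; last exact: mono.
  rewrite /b addrC -scaleN1r; apply: linspan_comb; first exact: mono.
  by apply: linspan_gen; rewrite /= inE eqxx.
have os y : y \in s -> inner y (x - (c *: b + px)) = 0.
  move=> ys; rewrite opprD addrCA innerDr ox// addr0.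
  by rewrite -scaleNr innerZr oa// mulr0.
have ob : inner b (x - (c *: b + px)) = 0.
  rewrite innerBr innerDr innerZr opx addr0 /c.
  (* When b = 0 the coefficient c is 0, the inverse of 0 being 0. *)
  have [bb0|bb0] := eqVneq (inner b b) 0.
    by rewrite bb0 mulr0 subr0 (inner_eq0 bb0) inner0l.
  by rewrite divfK// subrr.
move=> y /=; rewrite inE => /orP[/eqP ->|]; last exact: os.
rewrite -[a](subrK pa) innerDl -/b ob add0r.
exact: (orthocomplement_linspan os).
Qed.

Lemma adjoint_sym (T Ts : E -> E) : adjoint_of T Ts -> adjoint_of Ts T.
Proof. by move=> TTs u v; rewrite inner_conj -TTs -inner_conj. Qed.

Lemma adjoint_linear (T Ts : E -> E) : adjoint_of T Ts -> linear T.
Proof.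
move=> TTs a u v; apply: inner_ext => z.
by rewrite innerDr innerZr -!TTs innerDr innerZr.
Qed.

Lemma adjoint_scale (T Ts : E -> E) : adjoint_of T Ts ->
  forall a x, T (a *: x) = a *: T x.
Proof.
by move=> TTs a x; apply: inner_ext => z; rewrite innerZr -!TTs innerZr.
Qed.

(** The relation T* T = |c|^2 I, read off inner products.  The operators A, A_N
    and A^m all satisfy it, which is what gives the bounds, hence the continuity,
    and the behaviour of the adjoints. *)
Definition scales c (F : innerProductType R) (T : E -> F) : Prop :=
  forall u v, inner (T u) (T v) = `|c| ^+ 2 * inner u v.

Lemma scales_norm c (F : innerProductType R) (T : E -> F) : scales c T ->
  forall x, `|T x| = `|c| * `|x|.
Proof.
move=> Tc x; apply/eqP; rewrite -(eqrXn2 (ltn0Sn 1)) ?mulr_ge0//.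
by rewrite exprMn -!inner_normE Tc.
Qed.

Lemma scales_adjointK c (T Ts : E -> E) : scales c T -> adjoint_of T Ts ->
  forall x, Ts (T x) = `|c| ^+ 2 *: x.
Proof.
move=> Tc TTs x; apply: inner_ext => z.
by rewrite innerZr -(adjoint_sym TTs) Tc.
Qed.

(** Bounding |Ts x|^2 = <x, T (Ts x)> by Cauchy-Schwarz and dividing by
    |Ts x|. *)
Lemma scales_adjoint_norm c (T Ts : E -> E) : scales c T -> adjoint_of T Ts ->
  forall x, `|Ts x| <= `|c| * `|x|.
Proof.
move=> Tc TTs x; have [->|Tx0] := eqVneq `|Ts x| 0.
  by rewrite mulr_ge0.
have {Tx0} Tx0 : 0 < `|Ts x| by rewrite lt_def Tx0 normr_ge0.
rewrite -(ler_pM2r Tx0) -expr2 -inner_normE TTs.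
rewrite -(@ger0_norm _ (inner _ _)); last by rewrite -TTs inner_ge0.
by rewrite (le_trans (le_norm_inner _ _))// (scales_norm Tc) mulrCA mulrA.
Qed.

Lemma linear_lipschitz (F : innerProductType R) (T : E -> F) k :
  linear T -> (forall x, `|T x| <= k * `|x|) ->
  forall x y, `|T x - T y| <= k * `|x - y|.
Proof.
move=> lT kT x y.
have -> : T x - T y = T (x - y).
  by rewrite -scaleN1r addrC -lT scaleN1r addrC.
exact: kT.
Qed.

Lemma lipschitz_continuous (F : innerProductType R) (T : E -> F) k :
  0 <= k -> (forall x y, `|T x - T y| <= k * `|x - y|) -> continuous T.
Proof.
move=> k0 kT x; apply/cvgrPdist_lt => e e0.
have ek : 0 < e / (k + 1) by rewrite divr_gt0// ltr_wpDl.
near=> y.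
have : `|x - y| < e / (k + 1) by near: y; exact: cvgr_dist_lt.
rewrite ltr_pdivlMr ?ltr_wpDl// => /(le_lt_trans _); apply.
by rewrite (le_trans (kT _ _))// mulrC ler_wpM2l// lerDl.
Unshelve. all: by end_near. Qed.

(** Polarization: the defect d of inner-product preservation is sesquilinear and
    vanishes on the diagonal, so expanding d (a y + x) (a y + x) for a = 1 and
    a = i kills d x y. *)
Lemma norm_preserving_inner (F : innerProductType R) (f : E -> F) :
  linear f -> (forall x, `|f x| = `|x|) ->
  forall x y, inner (f x) (f y) = inner x y.
Proof.
move=> lf nf x y.
pose d u v := inner (f u) (f v) - inner u v.
have d0 u : d u u = 0 by rewrite /d !inner_normE nf subrr.
have dP a : d x y * a + d y x * Num.conj a = 0.
  have := d0 (a *: y + x).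
  rewrite /d lf !innerDr !innerDl !innerZr !innerZl !inner_normE !nf.
  move: (inner _ _) (inner _ _) (inner _ _) (inner _ _) => p q s t.
  by move=> <-; ring.
have := dP 1; have := dP 'i.
rewrite conjCi rmorph1 !mulr1 mulrN -mulrBl.
move=> /eqP; rewrite mulf_eq0 (negbTE (neq0Ci _)) orbF => /eqP e1 e2.
have : d x y *+ 2 = 0.
  by rewrite mulr2n -[X in X + _](subrK (d y x)) e1 add0r addrC.
by move/eqP; rewrite mulrn_eq0/= subr_eq0 => /eqP.
Qed.

Lemma scales_continuous c (T Ts : E -> E) :
  scales c T -> adjoint_of T Ts -> continuous T /\ continuous Ts.
Proof.
move=> Tc TTs; split; apply: (lipschitz_continuous (normr_ge0 c)).
  apply: linear_lipschitz (adjoint_linear TTs) _ => x.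
  by rewrite (scales_norm Tc).
apply: linear_lipschitz (adjoint_linear (adjoint_sym TTs)) _.
exact: scales_adjoint_norm TTs.
Qed.

Lemma unitary_scales q (V A : E -> E) : unitary V ->
  (forall x, A x = q *: V x) -> scales q A.
Proof.
move=> [_ Vinner _] AE u v.
by rewrite !AE innerZl innerZr Vinner// mulrA normCK [q * _]mulrC.
Qed.

Lemma linear_isometry_iso (F : innerProductType R) (f : E -> F) :
  linear f -> (forall x y, inner (f x) (f y) = inner x y) ->
  isometric_iso [set: E] (range f) f.
Proof.
move=> lf fi; split=> [a u v _ _|//|]; first exact: lf.
split=> [x _|x y _ _ fxy|].
- by exists x.
- by apply: inner_ext => z; rewrite -!fi fxy.
- by move=> _ [x _ <-]; exists x.
Qed.
End Inner.

(** * The orbit of a vector under polynomials in two operators *)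

Section Monomials.
Context {R : realType} {E : lmodType R[i]} (A As : E -> E) (u : E).
Local Notation mono i j := (iter i A (iter j As u)).
Implicit Types P Q : {poly {poly R[i]}}.

Definition monomials : set E := [set v | exists i j, v = mono i j].

(** Summing over a common index range lets polynomials of different degrees be
    added. *)
Lemma poly2_op_widen P m n : (size P <= m)%N ->
  (forall i, (size (P`_i)%R <= n)%N) ->
  poly2_op P A As u = \sum_(i < m) \sum_(j < n) P`_i`_j *: mono i j.
Proof.
move=> Pm Pn; rewrite /poly2_op.
have inner_widen i : \sum_(j < size P`_i) P`_i`_j *: mono i j =
    \sum_(j < n) P`_i`_j *: mono i j.
  rewrite (big_ord_widen n (fun j => P`_i`_j *: mono i j))// big_mkcond/=.
  apply: eq_bigr => j _; case: ltnP => // Pj.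
  by rewrite nth_default// scale0r.
under eq_bigr => i _ do rewrite inner_widen.
rewrite (big_ord_widen m (fun i => \sum_(j < n) P`_i`_j *: mono i j))//.
rewrite big_mkcond/=; apply: eq_bigr => i _; case: ltnP => // Pi.
by rewrite big1// => j _; rewrite [P`_i]nth_default// coef0 scale0r.
Qed.

Lemma poly2_op_size (P : {poly {poly R[i]}}) :
  exists n, forall i, (size (P`_i)%R <= n)%N.
Proof.
exists (\max_(i < size P) size (P`_i)%R) => i; have [iP|Pi] := ltnP i (size P).
  exact: (leq_bigmax (Ordinal iP)).
by rewrite [P`_i]nth_default// size_poly0.
Qed.

Lemma poly2_opD P Q :
  poly2_op (P + Q) A As u = poly2_op P A As u + poly2_op Q A As u.
Proof.
have [p Pp] := poly2_op_size P; have [q Qq] := poly2_op_size Q.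
pose m := maxn (size P) (size Q); pose n := maxn p q.
have Pn i : (size (P`_i)%R <= n)%N by rewrite (leq_trans (Pp i))// leq_maxl.
have Qn i : (size (Q`_i)%R <= n)%N by rewrite (leq_trans (Qq i))// leq_maxr.
rewrite (@poly2_op_widen P m n) ?leq_maxl// (@poly2_op_widen Q m n) ?leq_maxr//.
rewrite (@poly2_op_widen (P + Q) m n) ?size_polyD//; last first.
  by move=> i; rewrite coefD (leq_trans (size_polyD _ _))// geq_max Pn Qn.
rewrite -big_split/=; apply: eq_bigr => i _; rewrite -big_split/=.
by apply: eq_bigr => j _; rewrite !coefD scalerDl.
Qed.

Lemma poly2_op_monomial c i j :
  poly2_op ((c *: 'X^j) *: 'X^i) A As u = c *: mono i j.
Proof.
rewrite (@poly2_op_widen _ i.+1 j.+1).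
- rewrite big_ord_recr big1 ?add0r/=; last first.
    move=> k _; rewrite big1// => l _.
    by rewrite coefZ coefXn ltn_eqF// mulr0 coef0 scale0r.
  rewrite coefZ coefXn eqxx mulr1 big_ord_recr big1 ?add0r/=; last first.
    by move=> l _; rewrite coefZ coefXn ltn_eqF// mulr0 scale0r.
  by rewrite coefZ coefXn eqxx mulr1 add0r.
- - by rewrite (leq_trans (size_scale_leq _ _))// size_polyXn.
- move=> k; rewrite coefZ coefXn; case: (k == i).
    by rewrite mulr1 (leq_trans (size_scale_leq _ _))// size_polyXn.
  by rewrite mulr0 size_poly0.
Qed.

(** Turns the orbit into a linear span, so that its stability under linear maps
    can be checked on monomials and linspan_eventually applies to it. *)
Lemma poly2_orbitE : poly2_orbit A As u = linspan monomials.
Proof.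
rewrite eqEsubset; split=> v.
  move=> [P _ <-]; apply/linspanP/rpred_sum => i _; apply/rpred_sum => j _.
  by apply/rpredZ/linspanP/linspan_gen; exists i, j.
move=> [n [c [s [Ss ->]]]]; elim/big_ind: _ => [|x y [P _ <-] [Q _ <-]|k _].
- by exists 0 => //; rewrite /poly2_op size_poly0 big_ord0.
- by exists (P + Q); rewrite ?poly2_opD.
- have [i [j ->]] := Ss k; exists ((c k *: 'X^j) *: 'X^i) => //.
  exact: poly2_op_monomial.
Qed.
End Monomials.

(** * Operators induced on the metric ultraproduct *)

Section Ultra.
Context {R : realType} (U : square_ultrafilter) {E : nat -> innerProductType R}.
Implicit Types (u v : forall N, E N) (x y : mspace U E).

Definition nat_bounded u := exists n : nat, ufilter U [set N | `|u N| <= n%:R].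

Lemma mspace_repr x : exists2 u, nat_bounded u & x = mvec U u.
Proof.
exists (brep (mrep x)); first exact: brep_bounded.
by rewrite mvec_brep; exact/esym/mrepK.
Qed.

Lemma mvec_near u v : ufilter U [set N | u N = v N] -> mvec U u = mvec U v.
Proof. by move=> /uclsP uv; rewrite /mvec /uvec uv. Qed.

Lemma mvec_comb a u v : nat_bounded u -> nat_bounded v ->
  mvec U (fun N => a *: u N + v N) = a *: mvec U u + mvec U v.
Proof.
move=> /bounded_predP ub /bounded_predP vb.
rewrite /mvec -mclsZ -mclsD; congr mcls; apply: val_inj.
have comb : uvec U (fun N => a *: u N + v N) = a *: uvec U u + uvec U v.
  by rewrite uscaleE uaddE.
rewrite linearP/= !insubdK// comb rpredD// rpredZ//.
Qed.

Lemma ulim_inner_mvec u v : nat_bounded u -> nat_bounded v ->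
  ulim U (fun N => inner (u N) (v N)) (inner (mvec U u) (mvec U v)).
Proof.
move=> [m um] [n vn]; apply: ulim_near (ulim_inner _ _).
by apply: filterS2 (brep_insubd um) (brep_insubd vn) => N /= -> ->.
Qed.

Lemma complex_archimedean (z : R[i]) : exists n : nat, `|z| <= n%:R.
Proof.
exists (Num.trunc (complex.Re `|z|)).+1.
rewrite -(RRe_real (normr_real z)) -(rmorph_nat (real_complex R)) lecR ltW//.
exact: truncnS_gt.
Qed.

Lemma nat_bounded_map (T : forall N, E N -> E N) (c : R[i]) :
  (forall N z, `|T N z| <= `|c| * `|z|) ->
  forall u, nat_bounded u -> nat_bounded (fun N => T N (u N)).
Proof.
have [k ck] := complex_archimedean c.
move=> T_le u [m um]; exists (k * m)%N; apply: filterS um => N /= um.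
by rewrite (le_trans (T_le _ _))// natrM ler_pM.
Qed.

Lemma minduced_mvec_linear (T : forall N, E N -> E N) (c : R[i]) :
  (forall N, linear (T N)) -> (forall N z, `|T N z| <= `|c| * `|z|) ->
  forall u, nat_bounded u ->
  minduced U T (mvec U u) = mvec U (fun N => T N (u N)).
Proof.
have [k ck] := complex_archimedean c.
move=> T_linear T_le u [m um]; apply: (@minduced_mvec R U E T k m) => // N.
  by apply/eqP; rewrite -normr_le0 (le_trans (T_le _ _))// normr0 mulr0.
apply: linear_lipschitz => // x.
by rewrite (le_trans (T_le _ _))// ler_wpM2r.
Qed.

Lemma minduced_scales (T : forall N, E N -> E N) c :
  (forall N, linear (T N)) -> (forall N, scales c (T N)) ->
  scales c (minduced U T).
Proof.
move=> lT Tc x y.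
have T_le N z : `|T N z| <= `|c| * `|z| by rewrite (scales_norm (Tc N)).
have [u ub ->] := mspace_repr x; have [v vb ->] := mspace_repr y.
rewrite !(minduced_mvec_linear lT T_le)//.
apply: ulim_unique (ulim_inner_mvec (nat_bounded_map T_le ub)
  (nat_bounded_map T_le vb)) _.
apply: ulim_near (ulimZ _ (ulim_inner_mvec ub vb)).
by apply: filterE => N /=; rewrite Tc.
Qed.

(** The inner products of the factors determine that of the ultraproduct through
    their limit, so the adjunction passes to the limit; likewise in
    minduced_scales.  The uniform bound |c| makes the induced operators well
    defined. *)
Lemma minduced_adjoint (T Ts : forall N, E N -> E N) c :
  (forall N, scales c (T N)) -> (forall N, adjoint_of (T N) (Ts N)) ->
  adjoint_of (minduced U T) (minduced U Ts).
Proof.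
move=> Tc TTs x y.
have lT N := adjoint_linear (TTs N).
have lTs N := adjoint_linear (adjoint_sym (TTs N)).
have T_le N z : `|T N z| <= `|c| * `|z| by rewrite (scales_norm (Tc N)).
have Ts_le N z := scales_adjoint_norm (Tc N) (TTs N) z.
have [u ub ->] := mspace_repr x; have [v vb ->] := mspace_repr y.
rewrite (minduced_mvec_linear lT T_le)// (minduced_mvec_linear lTs Ts_le)//.
apply: ulim_unique (ulim_inner_mvec (nat_bounded_map Ts_le ub) vb) _.
apply: ulim_near (ulim_inner_mvec ub (nat_bounded_map T_le vb)).
by apply: filterE => N /=; rewrite TTs.
Qed.
End Ultra.

(** * Truncations of a scaled unitary operator *)

Section ScaledUnitary.
Context {R : realType} {H : innerProductType R}.
Variables (A As : H -> H) (phi : H) (c : R[i]).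
Hypothesis c_neq0 : c != 0.
Hypothesis A_scales : scales c A.
Hypothesis A_surj : forall y, exists x, A x = y.
Hypothesis As_adjoint : adjoint_of A As.

Lemma scaled_unitary_adjointK x : A (As x) = `|c| ^+ 2 *: x.
Proof.
have [y <-] := A_surj x; rewrite (scales_adjointK A_scales As_adjoint).
exact: adjoint_scale As_adjoint _ _.
Qed.

Lemma scaled_unitary_comm x : As (A x) = A (As x).
Proof.
by rewrite scaled_unitary_adjointK (scales_adjointK A_scales As_adjoint).
Qed.

Lemma adjoint_iter i x : As (iter i A x) = iter i A (As x).
Proof. by elim: i => //= i <-; exact: scaled_unitary_comm. Qed.

Lemma orbit_comb a y z : poly2_orbit A As phi y -> poly2_orbit A As phi z ->
  poly2_orbit A As phi (a *: y + z).
Proof. by rewrite poly2_orbitE; exact: linspan_comb. Qed.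

Lemma orbit0 : poly2_orbit A As phi 0.
Proof. by rewrite poly2_orbitE; apply/linspanP; exact: rpred0. Qed.

Lemma orbit_A y : poly2_orbit A As phi y -> poly2_orbit A As phi (A y).
Proof.
rewrite poly2_orbitE; apply: linspan_map; first exact: adjoint_linear As_adjoint.
by move=> _ [i [j ->]]; apply: linspan_gen; exists i.+1, j.
Qed.

Lemma orbit_As y : poly2_orbit A As phi y -> poly2_orbit A As phi (As y).
Proof.
rewrite poly2_orbitE; apply: linspan_map.
  exact: adjoint_linear (adjoint_sym As_adjoint).
move=> _ [i [j ->]]; apply: linspan_gen; exists i, j.+1.
exact: adjoint_iter.
Qed.

(** The monomial A^i A*^j phi is a generator of H_N^- as soon as N > i and N >= j.
    Since the ultrafilter contains all final segments of the naturals, it follows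
    that A_N acts as A on a fixed vector of the orbit for almost all N. *)
Lemma orbit_minus (y : H) : poly2_orbit A As phi y ->
  exists n, forall N, (n <= N)%N -> linspan (orbit_upto_minus A As phi N) y.
Proof.
rewrite poly2_orbitE => Dy; apply: linspan_eventually.
  move=> m n _ mn [i [j [im jm ->]]]; exists i, j; split=> //.
    exact: leq_trans im mn.
  exact: leq_trans jm mn.
move: y Dy; apply: linspan_sub => _ [i [j ->]].
exists (maxn i.+1 j), i, j; split=> //.
  exact: leq_maxl.
exact: leq_maxr.
Qed.

Lemma linspan_minus_upto N v : linspan (orbit_upto_minus A As phi N) v ->
  linspan (orbit_upto A As phi N) v.
Proof.
apply: linspan_sub => _ [i [j [iN jN ->]]].
by exists i, j; split=> //; exact: ltnW.
Qed.

Lemma finite_orbit_minus N : finite_set (orbit_upto_minus A As phi N).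
Proof.
pose s := [seq iter i A (iter j As phi) | i <- iota 0 N, j <- iota 0 N.+1].
apply: (@sub_finite_set _ _ [set` s]); last exact: finite_seq.
move=> _ [i [j [iN jN ->]]].
suff : iter i A (iter j As phi) \in s by [].
apply/allpairsPdep; exists i, j.
by rewrite !mem_iota/= !add0n.
Qed.

(** The projection onto H_N^- exists because its generators are finitely many. *)
Lemma HN_decomposition N (u : HN A As phi N) :
  exists u1 u2, [/\ HNminus A As phi N u1, Wminus A As phi N u2 & u = u1 + u2].
Proof.
have [p p_minus p_ortho] := ortho_projection (finite_orbit_minus N) (val u).
have pN : p \in span_pred (orbit_upto A As phi N).
  exact/linspanP/linspan_minus_upto.
pose u1 : HN A As phi N := Sub p pN.
exists u1, (u - u1); split; last by rewrite subrKC.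
  exact: p_minus.
move=> v v_minus; rewrite -[inner v _]/(inner (val v) (val (u - u1))) raddfB/=.
exact: (orthocomplement_linspan p_ortho).
Qed.

(** * The operators A_N and their adjoints *)

Variables (UN : forall N, HN A As phi N -> HN A As phi N)
  (AN : forall N, {linear HN A As phi N -> HN A As phi N})
  (ANs : forall N, HN A As phi N -> HN A As phi N).
Hypothesis UN_unitary : forall N,
  isometric_iso (Wminus A As phi N) (Wplus A As phi N) (@UN N).
Hypothesis AN_minus : forall N u, HNminus A As phi N u ->
  val (AN N u) = A (val u).
Hypothesis AN_W : forall N u, Wminus A As phi N u ->
  AN N u = sqrtC (`|c| ^+ 2) *: UN u.
Hypothesis ANs_adjoint : forall N, adjoint_of (AN N) (@ANs N).

Lemma AN_HNplus N u : HNminus A As phi N u -> HNplus A As phi N (AN N u).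
Proof.
move=> u_minus; rewrite /HNplus/= AN_minus//.
apply: (linspan_map (adjoint_linear As_adjoint) _ u_minus).
by move=> _ [i [j [iN jN ->]]]; apply: linspan_gen; exists i.+1, j.
Qed.

(** Split both arguments along H_N = H_N^- + W^-.  The cross terms vanish because
    A_N maps H_N^- into H_N^+ and W^- into its orthogonal complement W^+; the
    diagonal terms are scaled by A and by U_N respectively. *)
Lemma AN_scales N : scales c (AN N).
Proof.
move=> u v.
have [u1 [u2 [u1m u2W ->]]] := HN_decomposition u.
have [v1 [v2 [v1m v2W ->]]] := HN_decomposition v.
have [_ UNinner [UNW _ _]] := UN_unitary N.
have plus_W x y : HNminus A As phi N x -> Wminus A As phi N y ->
    inner (AN N x) (AN N y) = 0.
  move=> xm yW; rewrite (AN_W yW) innerZr (UNW _ yW) ?mulr0//.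
  exact: AN_HNplus.
have minus_W x y : HNminus A As phi N x -> Wminus A As phi N y ->
    inner x y = 0 by move=> xm; apply.
have -> : inner (AN N (u1 + u2)) (AN N (v1 + v2)) =
    inner (AN N u1) (AN N v1) + inner (AN N u2) (AN N v2).
  rewrite !raddfD; apply: innerD_ortho; first exact: plus_W.
  by apply: inner_orthoC; exact: plus_W.
have -> : inner (u1 + u2) (v1 + v2) = inner u1 v1 + inner u2 v2.
  apply: innerD_ortho; first exact: minus_W.
  by apply: inner_orthoC; exact: minus_W.
rewrite mulrDr; congr (_ + _).
  rewrite -[inner (AN N u1) _]/(inner (val (AN N u1)) (val (AN N v1))).
  by rewrite !AN_minus// A_scales.
rewrite !AN_W// innerZl innerZr UNinner// sqrCK//.
by rewrite (CrealP (normr_real c)) mulrA expr2.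
Qed.

Variable U : square_ultrafilter.
Local Notation D := (poly2_orbit A As phi).
Local Notation mconst := (mconst A As phi U).

Lemma AN_eventually y : D y ->
  ufilter U [set N | AN N (insubd 0 y) = insubd 0 (A y)].
Proof.
move=> Dy; have [n yn] := orbit_minus Dy.
apply: filterS3 (ufilter_ge U n) (orbit_HN U Dy) (orbit_HN U (orbit_A Dy)).
move=> N /= nN yN AyN; apply: val_inj; rewrite AN_minus ?insubdK//.
by rewrite /HNminus/= insubdK//; exact: yn.
Qed.

(** The adjoint is not known explicitly on H_N.  But y = A z for
    z = r_A^-1 A* y, and for large N the vector z lies in H_N^-, where A_N agrees
    with A; so A_N* y = A_N* A_N z = r_A z = A* y. *)
Lemma ANs_eventually y : D y ->
  ufilter U [set N | ANs (insubd (0 : HN A As phi N) y) = insubd 0 (As y)].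
Proof.
move=> Dy; pose z := (`|c| ^+ 2)^-1 *: As y.
have r0 : `|c| ^+ 2 != 0 by rewrite expf_neq0// normr_eq0.
have Dz : D z.
  by rewrite -[z]addr0; apply: orbit_comb orbit0; exact: orbit_As.
have Az : A z = y.
  by rewrite (adjoint_scale As_adjoint) scaled_unitary_adjointK scalerK.
apply: filterS3 (AN_eventually Dz) (orbit_HN U Dz) (orbit_HN U (orbit_As Dy)).
move=> N /= ANz zN AsyN; apply: val_inj.
rewrite -Az -ANz (scales_adjointK (@AN_scales N) (@ANs_adjoint N)) Az.
by rewrite linearZ/= !insubdK// /z scalerA mulfV// scale1r.
Qed.

Lemma minduced_mconst (T : forall N, HN A As phi N -> HN A As phi N)
  (B : H -> H) y :
  (forall N, linear (@T N)) ->
  (forall N (x : HN A As phi N), `|T N x| <= `|c| * `|x|) ->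
  ufilter U [set N | T N (insubd 0 y) = insubd 0 (B y)] ->
  minduced U T (mconst y) = mconst (B y).
Proof.
move=> lT T_le TB.
rewrite (minduced_mvec_linear lT T_le); first exact: mvec_near.
exact: mconst_bounded.
Qed.

Lemma minduced_AN_mconst y : D y -> minduced U AN (mconst y) = mconst (A y).
Proof.
move=> Dy; apply: minduced_mconst (AN_eventually Dy) => N.
  exact: linearP.
by move=> x; rewrite (scales_norm (@AN_scales N)).
Qed.

Lemma minduced_ANs_mconst y : D y -> minduced U ANs (mconst y) = mconst (As y).
Proof.
move=> Dy; apply: minduced_mconst (ANs_eventually Dy) => N.
  exact: adjoint_linear (adjoint_sym (@ANs_adjoint N)).
exact: scales_adjoint_norm (@AN_scales N) (@ANs_adjoint N).
Qed.

(** * The embedding into the ultraproduct *)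

Hypothesis cyclic : dense D.
Local Notation G := (Gm A As phi U).

Lemma Gm_orbit y : D y -> G y = mconst y.
Proof. by move=> [P _ <-]; exact: Gm_poly2_op. Qed.

Lemma mconst_comb a y z : D y -> D z ->
  mconst (a *: y + z) = a *: mconst y + mconst z.
Proof.
move=> Dy Dz; rewrite /Defs.mconst -mvec_comb; try exact: mconst_bounded.
apply: mvec_near.
apply: filterS3 (orbit_HN U Dy) (orbit_HN U Dz) (orbit_HN U (orbit_comb a Dy Dz)).
by move=> N /= yN zN yzN; apply: val_inj; rewrite linearP/= !insubdK.
Qed.

(** Density is applied in one variable at a time, first y and then x. *)
Lemma Gm_linear : linear G.
Proof.
have cG : continuous G := Gm_continuous cyclic.
move=> a x y; move: y.
apply: (@dense_eq _ _ D (fun y => G (a *: x + y))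
  (fun y => a *: G x + G y)) => //.
- have cxy : continuous (fun y => a *: x + y).
    by apply: continuous_comb => z; [exact: cvg_cst|exact: cvg_id].
  by move=> y; apply: continuous_comp; [exact: cxy|exact: cG].
- by apply: continuous_comb; [move=> z; exact: cvg_cst|exact: cG].
move=> y Dy; move: x.
apply: (@dense_eq _ _ D (fun x => G (a *: x + y))
  (fun x => a *: G x + G y)) => //.
- have cxy : continuous (fun x => a *: x + y).
    by apply: continuous_comb => z; [exact: cvg_id|exact: cvg_cst].
  by move=> x; apply: continuous_comp; [exact: cxy|exact: cG].
- by apply: continuous_comb; [exact: cG|move=> z; exact: cvg_cst].
by move=> x Dx; rewrite !Gm_orbit ?mconst_comb//; exact: orbit_comb.
Qed.

Lemma Gm_norm x : `|G x| = `|x|.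
Proof.
have cG : continuous G := Gm_continuous cyclic.
have D0 := orbit0.
have G0 : mconst 0 = 0.
  have := Gm_linear (-1) 0 0.
  by rewrite scaler0 addr0 scaleN1r addNr Gm_orbit.
move: x; apply: (@dense_eq _ R[i]^o D (fun x => `|G x|) (fun x => `|x|)) => //.
- by move=> x; apply: cvg_norm; exact: cG.
- by move=> x; apply: cvg_norm; exact: cvg_id.
move=> x Dx; rewrite Gm_orbit// -[mconst x]subr0 -G0.
by rewrite (@mconst_isometric _ _ _ _ _ _ x 0)// subr0.
Qed.

Lemma Gm_inner x y : inner (G x) (G y) = inner x y.
Proof. exact: (norm_preserving_inner Gm_linear Gm_norm). Qed.

Lemma Gm_intertwines (B : H -> H)
  (T : mspace U (HN A As phi) -> mspace U (HN A As phi)) :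
  continuous B -> continuous T ->
  (forall y, D y -> D (B y)) -> (forall y, D y -> T (mconst y) = mconst (B y)) ->
  G \o B = T \o G.
Proof.
move=> cB cT DB TB; have cG : continuous G := Gm_continuous cyclic.
apply: functional_extensionality_dep.
apply: (@dense_eq _ _ D (G \o B) (T \o G)) => //.
- by move=> x; apply: continuous_comp; [exact: cB|exact: cG].
- by move=> x; apply: continuous_comp; [exact: cG|exact: cT].
by move=> y Dy /=; rewrite !Gm_orbit ?TB//; exact: DB.
Qed.
End ScaledUnitary.

(** * Intertwining and adjunction *)

Theorem lemma1p6 (R : realType) (H : hilbertType R) (Hsep : separable H)
  (q : R[i]) (q_neq0 : q != 0) (V : H -> H) (V_unitary : unitary V)
  (A : H -> H) (AE : forall x, A x = q *: V x)
  (As : H -> H) (As_adjoint : adjoint_of A As)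
  (phi : H) (phi_norm : `|phi| = 1)
  (phi_cyclic : dense (poly2_orbit A As phi))
  (UN : forall N, HN A As phi N -> HN A As phi N)
  (UN_unitary : forall N,
     isometric_iso (Wminus A As phi N) (Wplus A As phi N) (UN N))
  (AN : forall N, {linear HN A As phi N -> HN A As phi N})
  (AN_minus : forall N u, HNminus A As phi N u -> val (AN N u) = A (val u))
  (AN_W : forall N u, Wminus A As phi N u ->
     AN N u = sqrtC (`|q| ^+ 2) *: UN N u)
  (ANs : forall N, HN A As phi N -> HN A As phi N)
  (ANs_adjoint : forall N, adjoint_of (AN N) (ANs N))
  (U : square_ultrafilter) :
  let G := Gm A As phi U in
  let Am := minduced U AN in
  let Asm := minduced U ANs in
  [/\ isometric_iso [set: H] (HIm A As phi U) G,
      G \o A = Am \o G,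
      G \o As = Asm \o G,
      adjoint_of Am Asm &
      adjoint_on (HIm A As phi U) Am Asm].
Proof.
move=> G Am Asm.
have A_scales := unitary_scales V_unitary AE.
have A_surj y : exists x, A x = y.
  have [Vlin _ [_ _ Vsurj]] := V_unitary.
  have [x _ Vx] := Vsurj (q^-1 *: y) I.
  by exists x; rewrite AE Vx scalerA mulfV// scale1r.
have ANq N : scales q (AN N).
  exact: (AN_scales A_scales As_adjoint UN_unitary AN_minus AN_W).
have Am_scales : scales q Am.
  by apply: minduced_scales => // N; exact: linearP.
have Am_adjoint : adjoint_of Am Asm := minduced_adjoint ANq ANs_adjoint.
have [cA cAs] := scales_continuous A_scales As_adjoint.
have [cAm cAsm] := scales_continuous Am_scales Am_adjoint.
have GA : G \o A = Am \o G.
  apply: Gm_intertwines => // y; first exact: orbit_A.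
  exact: (minduced_AN_mconst A_scales As_adjoint UN_unitary AN_minus AN_W).
have GAs : G \o As = Asm \o G.
  apply: Gm_intertwines => // y; first exact: orbit_As.
  exact: (minduced_ANs_mconst q_neq0 A_scales A_surj As_adjoint UN_unitary
    AN_minus AN_W ANs_adjoint).
split=> //.
  apply: linear_isometry_iso; [exact: Gm_linear|exact: Gm_inner].
split=> [_ [x _ <-]|_ [x _ <-]|u v _ _]; last exact: Am_adjoint.
  by rewrite -[Am _]/((Am \o G) x) -GA; exists (A x).
by rewrite -[Asm _]/((Asm \o G) x) -GAs; exists (As x).
Qed.
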